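(* Let $X,U,Y$ be real Hilbert spaces and let $A,f,g,h,C,S$ be as in the context. Suppose that the semiglobal input-to-state stability assumption (ISS) and the invariant graph assumption (IG) of the context hold, and let $\mathcal{M}$ be the map provided by (IG). Suppose that $$\operatorname{Range}\,\mathrm{d}\mathcal{M}(0)g(0)=Y$$ and that, in addition, (i) the linear semigroup $\{e^{tA}\}_{t\geq0}$ is exponentially stable; (ii) $Y$ is finite-dimensional. Then the zero equilibrium is globally asymptotically stable in $X\times Y$ for the closed-loop system $$\dot{x} = Ax + f(x) + g(x)u,\qquad \dot{z} = Sz + Cx + h(x),\qquad u = g(x)^*\,\mathrm{d}\mathcal{M}(x)^*[z - \mathcal{M}(x)].$$
   Context: Conventions. $\mathcal{L}(E_1,E_2)$ is the space of bounded linear operators between normed spaces, with the operator norm; $\mathcal{C}^1(E_1,E_2)$ is the space of continuously Fréchet differentiable maps, with differential $\mathrm{d}f: E_1\to\mathcal{L}(E_1,E_2)$. A map is called locally Lipschitz continuous if it is Lipschitz continuous on every bounded subset. $L^*$ denotes the Hilbert adjoint of $L$. Data. $A:\mathcal{D}(A)\to X$ is the infinitesimal generator of a strongly continuous semigroup $\{e^{tA}\}_{t\geq 0}$ on $X$, and $\mathcal{D}(A)$ carries the graph norm; $f:X\to X$ is locally Lipschitz continuous with $f(0)=0$; $g:X\to\mathcal{L}(U,X)$ is locally Lipschitz continuous; $h:X\to Y$ is locally Lipschitz continuous with $h(0)=0$; $C\in\mathcal{L}(\mathcal{D}(A),Y)$; $S\in\mathcal{L}(Y)$ is skew-adjoint,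 $S^*=-S$. A functional $V\in\mathcal{C}^1(X,\mathbb{R})$ is quadratic-like if there exist $m_1,m_2>0$ with $m_1\|x\|_X^2\leq V(x)\leq m_2\|x\|_X^2$ for all $x\in X$. (ISS) There exist a quadratic-like $V\in\mathcal{C}^1(X,\mathbb{R})$ and $\beta>0$ such that $\mathrm{d}V(x)[Ax+f(x)+g(x)u]\leq\beta\|u\|_U^2$ for all $x\in\mathcal{D}(A)$, $u\in U$. Moreover, for any bounded open set $\mathcal{B}\subset X$ there exist a quadratic-like $V_{\mathcal{B}}\in\mathcal{C}^1(X,\mathbb{R})$ and $\alpha_{\mathcal{B}},\beta_{\mathcal{B}}>0$ such that $\mathrm{d}V_{\mathcal{B}}(x)[Ax+f(x)+g(x)u]\leq-\alpha_{\mathcal{B}}V_{\mathcal{B}}(x)+\beta_{\mathcal{B}}\|u\|_U^2$ for all $x\in\mathcal{D}(A)\cap\mathcal{B}$, $u\in U$. (IG) There exists $\mathcal{M}\in\mathcal{C}^1(X,Y)$ with $\mathrm{d}\mathcal{M}$ locally Lipschitz continuous such that $\mathcal{M}(0)=0$ and $\mathrm{d}\mathcal{M}(x)(Ax+f(x))=S\mathcal{M}(x)+Cx+h(x)$ for all $x\in\mathcal{D}(A)$. Solutions. Under these assumptions the closed-loop system has a unique global mild solution $[x,z]\in\mathcal{C}([0,\infty),X\times Y)$ for each $[x_0,z_0]\in X\times Y$, where the closed loop is viewed as a locally Lipschitz perturbation of the strongly continuous semigroup on $X\times Y$ generated by $[x,z]\mapsto[Ax,Cx]$ with domain $\mathcal{D}(A)\times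 Y$; mild solutions are those of the corresponding variation-of-constants formula, they depend continuously on the initial data uniformly on compact time intervals, and they are classical if $[x_0,z_0]\in\mathcal{D}(A)\times Y$. Global asymptotic stability of the zero equilibrium means that it is Lyapunov stable (for every $\epsilon>0$ there is $\delta>0$ such that $\|[x_0,z_0]\|_{X\times Y}<\delta$ implies $\|[x(t),z(t)]\|_{X\times Y}<\epsilon$ for all $t\geq0$) and globally attractive ($[x(t),z(t)]\to0$ in $X\times Y$ as $t\to+\infty$ for every $[x_0,z_0]\in X\times Y$). *)

(* Defs.v *)
From Stdlib Require Import Reals Lra FunctionalExtensionality ProofIrrelevance.
From Coquelicot Require Import Coquelicot.

Set Implicit Arguments.
Unset Strict Implicit.
Unset Printing Implicit Defensive.

Open Scope R_scope.

Notation NormedSpace := (NormedModule R_AbsRing).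

Lemma norm_scal_R (E : NormedSpace) (k : R) (x : E) : norm (scal k x) = Rabs k * norm x.
Proof.
apply Rle_antisym; [apply (norm_scal k x)|].
destruct (Req_dec k 0) as [->|Hk]; [rewrite Rabs_R0, Rmult_0_l; apply norm_ge_0|].
assert (Hp := Rabs_pos_lt _ Hk).
assert (H := norm_scal (/ k) (scal k x)).
rewrite scal_assoc in H.
change (mult (/ k) k) with (/ k * k) in H.
rewrite Rinv_l in H by assumption.
change 1 with (@one R_AbsRing) in H; rewrite scal_one in H.
change (norm x <= Rabs (/ k) * norm (scal k x)) in H.
rewrite Rabs_inv in H.
apply (Rmult_le_compat_l (Rabs k)) in H; [|lra].
rewrite <- Rmult_assoc, Rinv_r, Rmult_1_l in H by lra.
exact H.
Qed.

(* Coquelicot's [is_linear] includes boundedness. *)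
Record Lin (E F : NormedSpace) : Type := mkLin {
  lin_fun :> E -> F;
  lin_linear : is_linear lin_fun
}.

Section BoundedOperators.

Variables E F : NormedSpace.
Implicit Types L : Lin E F.

Lemma Lin_eq L1 L2 : (forall x, L1 x = L2 x) -> L1 = L2.
Proof.
destruct L1 as [f1 H1], L2 as [f2 H2]; simpl; intros H.
assert (f1 = f2) by (apply functional_extensionality; exact H).
subst f2; f_equal; apply proof_irrelevance.
Qed.

Definition Lin_plus L1 L2 : Lin E F :=
  mkLin (is_linear_comp (fun x => (L1 x, L2 x)) _
           (is_linear_prod _ _ (lin_linear L1) (lin_linear L2)) is_linear_plus).

Definition Lin_opp L : Lin E F :=
  mkLin (is_linear_comp L _ (lin_linear L) is_linear_opp).

Definition Lin_zero : Lin E F := mkLin is_linear_zero.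

Definition Lin_scal (k : R) L : Lin E F :=
  mkLin (is_linear_comp L _ (lin_linear L) (is_linear_scal_r k Rmult_comm)).

Definition Lin_AbelianMonoid_mixin : AbelianMonoid.mixin_of (Lin E F).
Proof.
apply (@AbelianMonoid.Mixin (Lin E F) Lin_plus Lin_zero); intros;
  apply Lin_eq; intros; simpl.
- apply plus_comm.
- apply plus_assoc.
- apply plus_zero_r.
Defined.

Canonical Lin_AbelianMonoid :=
  AbelianMonoid.Pack (Lin E F) Lin_AbelianMonoid_mixin (Lin E F).

Definition Lin_AbelianGroup_mixin : AbelianGroup.mixin_of Lin_AbelianMonoid.
Proof.
apply (@AbelianGroup.Mixin Lin_AbelianMonoid Lin_opp); intros;
  apply Lin_eq; intros; simpl.
apply (plus_opp_r (G := F)).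
Defined.

Canonical Lin_AbelianGroup :=
  AbelianGroup.Pack (Lin E F) (AbelianGroup.Class _ _ Lin_AbelianGroup_mixin) (Lin E F).

Definition Lin_ModuleSpace_mixin : ModuleSpace.mixin_of R_AbsRing Lin_AbelianGroup.
Proof.
apply (@ModuleSpace.Mixin R_AbsRing Lin_AbelianGroup Lin_scal); intros;
  apply Lin_eq; intros; simpl.
- apply scal_assoc.
- apply (scal_one (V := F)).
- apply (scal_distr_l (V := F)).
- apply (scal_distr_r (V := F)).
Defined.

Canonical Lin_ModuleSpace :=
  ModuleSpace.Pack R_AbsRing (Lin E F)
    (ModuleSpace.Class _ _ _ Lin_ModuleSpace_mixin) (Lin E F).

Definition opnorm L : R :=
  real (Lub_Rbar (fun r => exists x, norm x <= 1 /\ r = norm (L x))).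

Lemma opnorm_finite L : exists r : R,
  Lub_Rbar (fun r => exists x, norm x <= 1 /\ r = norm (L x)) = Finite r.
Proof.
set (P := fun r => exists x, norm x <= 1 /\ r = norm (L x)).
destruct (Lub_Rbar_correct P) as [H1 H2].
destruct (linear_norm _ (lin_linear L)) as [M [HM1 HM2]].
assert (HP : P 0).
{ exists zero; split; [rewrite norm_zero; lra|].
  rewrite (linear_zero L (lin_linear L)), norm_zero; easy. }
destruct (Lub_Rbar P) as [r| |].
- now exists r.
- exfalso; apply (H2 (Finite M)).
  intros r [x [Hx ->]]; simpl.
  apply Rle_trans with (1 := HM2 x); nra.
- exfalso; apply (H1 0 HP).
Qed.

Lemma opnorm_le L M : 0 <= M -> (forall x, norm (L x) <= M * norm x) -> opnorm L <= M.
Proof.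
intros HM H.
destruct (opnorm_finite L) as [r Hr]; unfold opnorm; rewrite Hr; simpl.
destruct (Lub_Rbar_correct (fun r => exists x, norm x <= 1 /\ r = norm (L x)))
  as [_ H2].
rewrite Hr in H2; apply (H2 (Finite M)).
intros s [x [Hx ->]]; simpl.
apply Rle_trans with (1 := H x); nra.
Qed.

Lemma opnorm_ball L x : norm x <= 1 -> norm (L x) <= opnorm L.
Proof.
intros Hx.
destruct (opnorm_finite L) as [r Hr]; unfold opnorm; rewrite Hr; simpl.
destruct (Lub_Rbar_correct (fun r => exists x, norm x <= 1 /\ r = norm (L x)))
  as [H1 _].
rewrite Hr in H1; apply (H1 (norm (L x))).
now exists x.
Qed.

Lemma opnorm_ge0 L : 0 <= opnorm L.
Proof.
apply Rle_trans with (norm (L zero)); [apply norm_ge_0|].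
apply opnorm_ball; rewrite norm_zero; lra.
Qed.

Lemma opnorm_bound L x : norm (L x) <= opnorm L * norm x.
Proof.
destruct (Req_dec (norm x) 0) as [H0|H0].
- rewrite (norm_eq_zero _ H0), (linear_zero L (lin_linear L)), !norm_zero; lra.
- assert (Hp : 0 < norm x) by (generalize (norm_ge_0 x); lra).
  assert (H := opnorm_ball L (x := scal (/ norm x) x)).
  rewrite (linear_scal _ (lin_linear L)) in H.
  rewrite !norm_scal_R in H.
  rewrite (Rabs_pos_eq (/ norm x)) in H by (left; now apply Rinv_0_lt_compat).
  rewrite Rinv_l in H by assumption.
  specialize (H (Rle_refl 1)).
  apply (Rmult_le_compat_r (norm x)) in H; [|lra].
  replace (/ norm x * norm (L x) * norm x) with (norm (L x)) in H by (field; lra).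
  exact H.
Qed.

Lemma opnorm_triangle L1 L2 : opnorm (plus L1 L2) <= opnorm L1 + opnorm L2.
Proof.
apply opnorm_le.
- generalize (opnorm_ge0 L1) (opnorm_ge0 L2); lra.
- intros x; apply Rle_trans with (1 := norm_triangle (L1 x) (L2 x)).
  rewrite Rmult_plus_distr_r.
  apply Rplus_le_compat; apply opnorm_bound.
Qed.

Lemma opnorm_scal (k : R) L : opnorm (scal k L) <= abs k * opnorm L.
Proof.
apply opnorm_le.
- apply Rmult_le_pos; [apply abs_ge_0 | apply opnorm_ge0].
- intros x; apply Rle_trans with (1 := norm_scal k (L x)).
  rewrite Rmult_assoc; apply Rmult_le_compat_l; [apply abs_ge_0 | apply opnorm_bound].
Qed.

Lemma opnorm_eq_zero L : opnorm L = 0 -> L = zero.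
Proof.
intros H; apply Lin_eq; intros x; apply norm_eq_zero.
generalize (opnorm_bound L x) (norm_ge_0 (L x)); rewrite H; lra.
Qed.

Definition Lin_UniformSpace_mixin : UniformSpace.mixin_of (Lin E F).
Proof.
apply (@UniformSpace.Mixin (Lin E F) zero
         (fun L1 e L2 => opnorm (minus L2 L1) < e)).
- intros x e; rewrite minus_eq_zero.
  apply Rle_lt_trans with 0; [|apply cond_pos].
  apply opnorm_le; [lra|].
  intros y; simpl; rewrite norm_zero; lra.
- intros x y e H.
  replace (minus x y) with (scal (-1) (minus y x)).
  2: { rewrite <- (opp_minus y x).
       exact (scal_opp_one (minus y x : Lin_ModuleSpace)). }
  apply Rle_lt_trans with (1 := opnorm_scal _ _).
  change (abs (-1)) with (Rabs (-1)); rewrite Rabs_m1; lra.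
- intros x y z e1 e2 H1 H2.
  replace (minus z x) with (plus (minus y x) (minus z y)).
  + apply Rle_lt_trans with (1 := opnorm_triangle _ _); lra.
  + rewrite plus_comm; symmetry; apply minus_trans.
Defined.

Canonical Lin_UniformSpace :=
  UniformSpace.Pack (Lin E F) Lin_UniformSpace_mixin (Lin E F).

Canonical Lin_NormedModuleAux :=
  NormedModuleAux.Pack R_AbsRing (Lin E F)
    (NormedModuleAux.Class _ _ (ModuleSpace.class _ Lin_ModuleSpace)
       Lin_UniformSpace_mixin) (Lin E F).

Definition Lin_NormedModule_mixin : NormedModule.mixin_of R_AbsRing Lin_NormedModuleAux.
Proof.
apply (@NormedModule.Mixin R_AbsRing Lin_NormedModuleAux opnorm 1).
- exact opnorm_triangle.
- exact opnorm_scal.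
- intros x y e H; exact H.
- intros x y e H; rewrite Rmult_1_l; exact H.
- exact opnorm_eq_zero.
Defined.

Canonical Lin_NormedModule : NormedSpace :=
  NormedModule.Pack R_AbsRing (Lin E F)
    (NormedModule.Class _ _ _ Lin_NormedModule_mixin) (Lin E F).

End BoundedOperators.

Record RealHilbert : Type := mkRealHilbert {
  hilbert_sort :> CompleteNormedModule R_AbsRing;
  inner : hilbert_sort -> hilbert_sort -> R;
  inner_sym : forall x y, inner x y = inner y x;
  inner_plus_l : forall x y z, inner (plus x y) z = inner x z + inner y z;
  inner_scal_l : forall (k : R) x y, inner (scal k x) y = k * inner x y;
  inner_norm : forall x, inner x x = norm x ^ 2
}.

Section Riesz.

Variable H : RealHilbert.
Implicit Types x y z : H.

Lemma inner_plus_r x y z : inner x (plus y z) = inner x y + inner x z.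
Proof. now rewrite inner_sym, inner_plus_l, !(inner_sym x). Qed.

Lemma inner_scal_r (k : R) x y : inner x (scal k y) = k * inner x y.
Proof. now rewrite inner_sym, inner_scal_l, (inner_sym x). Qed.

Lemma inner_opp_l x y : inner (opp x) y = - inner x y.
Proof.
replace (opp x) with (scal (-1) x) by exact (scal_opp_one x).
rewrite inner_scal_l; ring.
Qed.

Lemma inner_opp_r x y : inner x (opp y) = - inner x y.
Proof. now rewrite inner_sym, inner_opp_l, inner_sym. Qed.

Lemma inner_ge0 x : 0 <= inner x x.
Proof. rewrite inner_norm; apply pow2_ge_0. Qed.

Lemma inner_eq x y : (forall z, inner z x = inner z y) -> x = y.
Proof.
intros Hxy.
assert (Hd : norm (minus x y) = 0).
{ assert (norm (minus x y) ^ 2 = 0).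
  { rewrite <- inner_norm; unfold minus at 2.
    rewrite inner_plus_r, inner_opp_r, Hxy; ring. }
  generalize (norm_ge_0 (minus x y)); nra. }
apply norm_eq_zero in Hd.
apply plus_reg_r with (opp y).
change (minus x y = minus y y); now rewrite Hd, minus_eq_zero.
Qed.

Lemma quadratic_nonneg_discr a b c :
  0 <= a -> (forall t, 0 <= a * t ^ 2 + 2 * b * t + c) -> b ^ 2 <= a * c.
Proof.
intros Ha Hq.
destruct (Req_dec a 0) as [->|Ha'].
- destruct (Req_dec b 0) as [->|Hb]; [lra|].
  specialize (Hq (- (c + 1) / (2 * b))).
  replace (0 * (- (c + 1) / (2 * b)) ^ 2 + 2 * b * (- (c + 1) / (2 * b)) + c)
    with (-1) in Hq by (field; lra); lra.
- specialize (Hq (- b / a)).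
  replace (a * (- b / a) ^ 2 + 2 * b * (- b / a) + c) with ((a * c - b ^ 2) / a) in Hq
    by (field; lra).
  apply (Rmult_le_compat_l a) in Hq; [|lra].
  replace (a * ((a * c - b ^ 2) / a)) with (a * c - b ^ 2) in Hq by (field; lra).
  lra.
Qed.

Lemma inner_Cauchy_Schwarz x y : Rabs (inner x y) <= norm x * norm y.
Proof.
assert (Hs : inner x y ^ 2 <= inner y y * inner x x).
{ apply quadratic_nonneg_discr; [apply inner_ge0|intros t].
  replace (_ + _ + _) with (inner (plus x (scal t y)) (plus x (scal t y)));
    [apply inner_ge0|].
  rewrite inner_plus_l, !inner_plus_r, !inner_scal_l, !inner_scal_r, (inner_sym y x).
  ring. }
rewrite !inner_norm in Hs.
apply Rsqr_incr_0_var.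
- rewrite <- Rsqr_abs; unfold Rsqr; lra.
- apply Rmult_le_pos; apply norm_ge_0.
Qed.

Lemma Riesz (l : Lin H R_NormedModule) : exists v, forall x, l x = inner x v.
Proof.
destruct (lin_linear l) as [lp ls [K [HK lb]]].
change (forall x, Rabs (l x) <= K * norm x) in lb.
change (forall x y, l (plus x y) = l x + l y) in lp.
change (forall (k : R) x, l (scal k x) = k * l x) in ls.
set (J := fun v => inner v v - 2 * l v).
destruct (completeness (fun r => exists v, r = - J v)) as [m' [Hm1 Hm2]].
{ exists (K ^ 2); intros r [v ->]; unfold J; rewrite inner_norm.
  generalize (Rle_trans _ _ _ (Rle_abs (l v)) (lb v)) (pow2_ge_0 (norm v - K)); nra. }
{ exists (- J zero); now exists zero. }
set (m := - m').
assert (HJ : forall v, m <= J v).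
{ intros v; unfold m.
  assert (- J v <= m') by (apply Hm1; now exists v); lra. }
assert (HJe : forall e, 0 < e -> exists v, J v < m + e).
{ intros e He; destruct (Classical_Prop.classic (exists v, J v < m + e)) as [He'|He'];
    [exact He'|exfalso].
  assert (m' <= m' - e); [|lra].
  apply Hm2; intros r [v ->].
  destruct (Rlt_le_dec (J v) (m + e)) as [Hv|Hv].
  - exfalso; apply He'; now exists v.
  - unfold m in Hv; lra. }
set (Fi := fun A : H -> Prop => exists e, 0 < e /\ forall v, J v < m + e -> A v).
assert (PFi : ProperFilter Fi).
{ split; [|split].
  - intros A [e [He HA]]; destruct (HJe e He) as [v Hv]; exists v; now apply HA.
  - exists 1; split; [lra|easy].
  - intros A B [e1 [He1 HA]] [e2 [He2 HB]].
    exists (Rmin e1 e2); split; [now apply Rmin_pos|].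
    intros v Hv; generalize (Rmin_l e1 e2) (Rmin_r e1 e2); intros.
    split; [apply HA|apply HB]; lra.
  - intros A B HAB [e [He HA]]; exists e; split; [easy|]; intros v Hv.
    apply HAB; now apply HA. }
assert (Cau : cauchy Fi).
{ intros eps; set (e := (eps / 3) ^ 2).
  assert (Heps := cond_pos eps).
  assert (He : 0 < e) by (unfold e; apply pow_lt; lra).
  destruct (HJe e He) as [u Hu]; exists u.
  exists e; split; [exact He|]; intros v Hv.
  apply (norm_compat1 u v).
  assert (Hm := HJ (scal (/ 2) (plus u v))).
  assert (Hp : norm (minus v u) ^ 2 <= 4 * e).
  { rewrite <- inner_norm.
    assert (Hid : inner (minus v u) (minus v u)
      = 2 * J u + 2 * J v - 4 * J (scal (/ 2) (plus u v))).
    { unfold J, minus.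
      rewrite ls, lp, !inner_scal_l, !inner_scal_r, !inner_plus_l, !inner_plus_r,
        !inner_opp_l, !inner_opp_r, (inner_sym v u).
      field. }
    rewrite Hid; lra. }
  apply Rsqr_incrst_0; [|apply norm_ge_0|lra].
  unfold Rsqr; unfold e in Hp.
  set (q := norm _) in Hp; change (q * q < eps * eps).
  assert (0 < eps * eps) by nra; simpl in Hp; lra. }
assert (Hlim := complete_cauchy Fi PFi Cau).
set (w := lim Fi) in Hlim.
exists w; intros x.
assert (Hv : forall v e, 0 < e -> J v < m + e ->
  Rabs (inner v x - l x) <= sqrt e * norm x).
{ intros v e He Hve.
  assert (Hs : (inner v x - l x) ^ 2 <= inner x x * e).
  { apply quadratic_nonneg_discr; [apply inner_ge0|intros t].
    assert (Ht := HJ (plus v (scal t x))); unfold J in Ht, Hve.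
    rewrite lp, ls, inner_plus_l, !inner_plus_r, !inner_scal_l, !inner_scal_r,
      (inner_sym x v) in Ht.
    lra. }
  rewrite inner_norm in Hs.
  apply Rsqr_incr_0_var.
  - rewrite <- Rsqr_abs; unfold Rsqr.
    replace (sqrt e * norm x * (sqrt e * norm x))
      with (sqrt e * sqrt e * norm x ^ 2) by ring.
    rewrite sqrt_sqrt by lra; simpl in Hs; lra.
  - apply Rmult_le_pos; [apply sqrt_pos|apply norm_ge_0]. }
set (nf := @norm_factor R_AbsRing H).
assert (Hnf : 0 < nf) by apply norm_factor_gt_0.
assert (Hd : forall d, 0 < d -> Rabs (inner w x - l x) <= d * ((nf + 1) * norm x)).
{ intros d Hd0.
  destruct (Hlim (mkposreal d Hd0)) as [e [He HB]].
  assert (Hd2 : 0 < d ^ 2) by (apply pow_lt; lra).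
  destruct (HJe (Rmin e (d ^ 2))) as [v Hvm]; [now apply Rmin_pos|].
  assert (Hb : ball w d v).
  { apply HB; generalize (Rmin_l e (d ^ 2)); lra. }
  assert (Hn := norm_compat2 w v (mkposreal d Hd0) Hb); simpl in Hn.
  fold nf in Hn.
  assert (H1 : Rabs (inner v x - l x) <= sqrt (d ^ 2) * norm x).
  { apply Hv; [exact Hd2|generalize (Rmin_r e (d ^ 2)); lra]. }
  rewrite sqrt_pow2 in H1 by lra.
  assert (H2 := inner_Cauchy_Schwarz (minus v w) x).
  unfold minus at 1 in H2; rewrite inner_plus_l, inner_opp_l in H2.
  replace (inner w x - l x)
    with ((inner v x - l x) + - (inner v x + - inner w x)) by ring.
  apply Rle_trans with (1 := Rabs_triang _ _).
  rewrite Rabs_Ropp.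
  assert (H3 := Rmult_le_compat_r (norm x) _ _ (norm_ge_0 x) (Rlt_le _ _ Hn)).
  apply Rle_trans with (1 := Rplus_le_compat _ _ _ _ H1 (Rle_trans _ _ _ H2 H3)).
  right; ring. }
rewrite (inner_sym x w).
destruct (Req_dec (inner w x - l x) 0) as [H0|H0]; [lra|exfalso].
assert (Hp := Rabs_pos_lt _ H0).
set (c := (nf + 1) * norm x) in Hd.
assert (Hc : 0 <= c).
{ apply Rmult_le_pos; [lra|apply norm_ge_0]. }
set (a := Rabs (inner w x - l x)) in *.
assert (Hd' := Hd (a / (2 * (c + 1)))).
assert (0 < a / (2 * (c + 1))) by (apply Rdiv_lt_0_compat; lra).
specialize (Hd' ltac:(assumption)).
apply (Rmult_le_compat_r (2 * (c + 1))) in Hd'; [|lra].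
replace (a / (2 * (c + 1)) * c * (2 * (c + 1))) with (a * c) in Hd' by (field; lra).
nra.
Qed.

End Riesz.

Section Adjoint.

Variables E F : RealHilbert.

(* [iota P] is Coquelicot's definite description: the unique element satisfying
   [P] whenever there is exactly one, which here is the Riesz representation
   theorem. *)
Definition adjoint_fun (L : Lin E F) (y : F) : E :=
  iota (fun v => forall x, inner (L x) y = inner x v).

Lemma adjoint_fun_spec (L : Lin E F) x y : inner (L x) y = inner x (adjoint_fun L y).
Proof.
revert x; unfold adjoint_fun.
apply (iota_correct (fun v => forall x, inner (L x) y = inner x v)).
assert (Hl : is_linear (K := R_AbsRing) (U := E) (V := R_NormedModule)
               (fun x => inner (L x) y)).
{ split.
  - intros x x'; rewrite (linear_plus _ (lin_linear L)); apply inner_plus_l.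
  - intros k x; rewrite (linear_scal _ (lin_linear L)); apply inner_scal_l.
  - exists (opnorm L * norm y + 1); split.
    + assert (0 <= opnorm L * norm y);
        [apply Rmult_le_pos; [apply opnorm_ge0|apply norm_ge_0]|lra].
    + intros x; change (Rabs (inner (L x) y) <= (opnorm L * norm y + 1) * norm x).
      apply Rle_trans with (1 := inner_Cauchy_Schwarz _ _).
      assert (Hx := opnorm_bound L x).
      apply (Rmult_le_compat_r (norm y)) in Hx; [|apply norm_ge_0].
      generalize (norm_ge_0 x); intros; simpl in *; lra. }
destruct (Riesz (mkLin Hl)) as [v Hv]; simpl in Hv.
exists v; split; [exact Hv|].
intros v' Hv'; apply inner_eq; intros z; now rewrite <- Hv, Hv'.
Qed.

Lemma adjoint_fun_linear (L : Lin E F) : is_linear (adjoint_fun L).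
Proof.
split.
- intros y y'; apply inner_eq; intros z.
  now rewrite inner_plus_r, <- !adjoint_fun_spec, inner_plus_r.
- intros k y; apply inner_eq; intros z.
  now rewrite inner_scal_r, <- !adjoint_fun_spec, inner_scal_r.
- exists (opnorm L + 1); assert (HL := opnorm_ge0 L); split; [lra|].
  intros y; set (v := adjoint_fun L y).
  assert (Hv : norm v ^ 2 <= opnorm L * norm v * norm y).
  { rewrite <- inner_norm; unfold v at 2; rewrite <- adjoint_fun_spec.
    apply Rle_trans with (1 := Rle_abs _).
    apply Rle_trans with (1 := inner_Cauchy_Schwarz _ _).
    apply Rmult_le_compat_r; [apply norm_ge_0|apply opnorm_bound]. }
  assert (Hv0 := norm_ge_0 v); assert (Hy0 := norm_ge_0 y).
  destruct (Req_dec (norm v) 0) as [->|Hn].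
  + apply Rmult_le_pos; lra.
  + apply Rle_trans with (opnorm L * norm y); [|lra].
    apply Rmult_le_reg_l with (norm v); [lra|].
    simpl in Hv; nra.
Qed.

Definition adjoint (L : Lin E F) : Lin F E := mkLin (adjoint_fun_linear L).

Lemma adjoint_spec (L : Lin E F) x y : inner (L x) y = inner x (adjoint L y).
Proof. apply adjoint_fun_spec. Qed.

End Adjoint.

Definition skew_adjoint (Y : RealHilbert) (S : Lin Y Y) : Prop := adjoint S = opp S.

(* [sum_n _ n] has the n+1 terms 0..n; the family [e] spans but need not be free. *)
Definition finite_dimensional (Y : NormedSpace) : Prop :=
  exists (n : nat) (e : nat -> Y),
    forall y, exists a : nat -> R, y = sum_n (fun i => scal (a i) (e i)) n.

Definition bounded_set (E : NormedSpace) (B : E -> Prop) : Prop :=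
  exists r : R, forall x, B x -> norm x <= r.

Definition locally_lipschitz (E F : NormedSpace) (f : E -> F) : Prop :=
  forall B : E -> Prop, bounded_set B ->
    exists K : R, forall x y, B x -> B y ->
      norm (minus (f x) (f y)) <= K * norm (minus x y).

Definition is_C1 (E F : NormedSpace) (f : E -> F) (df : E -> Lin E F) : Prop :=
  (forall x, filterdiff f (locally x) (df x)) /\
  (forall x, continuous df x).

(* An unbounded operator is a pair [(D, A)]: a domain [D : E -> Prop] and a total
   function [A : E -> E] whose values outside [D] are irrelevant. *)

Record is_C0_semigroup (E : NormedSpace) (T : R -> Lin E E) : Prop := {
  semigroup_0 : forall x, T 0 x = x;
  semigroup_plus : forall s t x, 0 <= s -> 0 <= t -> T (s + t) x = T s (T t x);
  semigroup_cont : forall x, filterlim (fun t => T t x) (at_right 0) (locally x)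
}.

Definition is_generator (E : NormedSpace) (T : R -> Lin E E)
    (D : E -> Prop) (A : E -> E) : Prop :=
  forall x y, (D x /\ A x = y) <->
    filterlim (fun t => scal (/ t) (minus (T t x) x)) (at_right 0) (locally y).

Definition exponentially_stable (E : NormedSpace) (T : R -> Lin E E) : Prop :=
  exists M omega : R, 0 < omega /\
    forall t, 0 <= t -> norm (T t) <= M * exp (- omega * t).

Definition graph_norm (E : NormedSpace) (A : E -> E) (x : E) : R :=
  sqrt (norm x ^ 2 + norm (A x) ^ 2).

(* [C] belongs to L(D(A), F), where D(A) carries the graph norm; as for [A], only
   the values of [C] on [D] matter. *)
Record bounded_on_domain (E F : NormedSpace) (D : E -> Prop) (A : E -> E)
    (C : E -> F) : Prop := {
  domain_plus : forall x y, D x -> D y -> C (plus x y) = plus (C x) (C y);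
  domain_scal : forall (k : R) x, D x -> C (scal k x) = scal k (C x);
  domain_bound : exists c : R, forall x, D x -> norm (C x) <= c * graph_norm A x
}.

Definition quadratic_like (E : NormedSpace) (V : E -> R) : Prop :=
  exists m1 m2 : R, 0 < m1 /\ 0 < m2 /\
    forall x, m1 * norm x ^ 2 <= V x <= m2 * norm x ^ 2.

Definition semiglobal_ISS (X U : NormedSpace) (D : X -> Prop) (A f : X -> X)
    (g : X -> Lin U X) : Prop :=
  (exists (V : X -> R_NormedModule) (dV : X -> Lin X R_NormedModule) (beta : R),
     is_C1 V dV /\ quadratic_like V /\ 0 < beta /\
     forall x u, D x ->
       dV x (plus (plus (A x) (f x)) (g x u)) <= beta * norm u ^ 2) /\
  (forall B : X -> Prop, bounded_set B -> open B ->
     exists (V : X -> R_NormedModule) (dV : X -> Lin X R_NormedModule)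
       (alpha beta : R),
       is_C1 V dV /\ quadratic_like V /\ 0 < alpha /\ 0 < beta /\
       forall x u, D x -> B x ->
         dV x (plus (plus (A x) (f x)) (g x u)) <= - alpha * V x + beta * norm u ^ 2).

Definition invariant_graph (X Y : NormedSpace) (D : X -> Prop) (A f : X -> X)
    (S : Lin Y Y) (C h : X -> Y) (M : X -> Y) (dM : X -> Lin X Y) : Prop :=
  is_C1 M dM /\ locally_lipschitz dM /\ M zero = zero /\
  forall x, D x ->
    dM x (plus (A x) (f x)) = plus (plus (S (M x)) (C x)) (h x).

(* [w] is a global mild solution of w' = G w + Phi(w), w(0) = w0, where (D, G)
   generates the strongly continuous semigroup [T] (which is determined by (D, G)). *)
Definition is_mild_solution (E : NormedSpace) (D : E -> Prop) (G Phi : E -> E)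
    (w0 : E) (w : R -> E) : Prop :=
  continuous_on (fun t => 0 <= t) w /\
  exists T : R -> Lin E E,
    is_C0_semigroup T /\ is_generator T D G /\
    forall t, 0 <= t ->
      exists v, is_RInt (fun s => T (t - s) (Phi (w s))) 0 t v /\
        w t = plus (T t w0) v.

(* [sol w0 w] reads: [w] is a global solution with initial datum [w0]. *)
Definition lyapunov_stable (E : NormedSpace) (sol : E -> (R -> E) -> Prop) : Prop :=
  forall eps, 0 < eps -> exists delta, 0 < delta /\
    forall w0 w, sol w0 w -> norm w0 < delta -> forall t, 0 <= t -> norm (w t) < eps.

Definition globally_attractive (E : NormedSpace) (sol : E -> (R -> E) -> Prop) : Prop :=
  forall w0 w, sol w0 w -> filterlim w (Rbar_locally p_infty) (locally (zero : E)).

Definition globally_asymptotically_stable (E : NormedSpace)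
    (sol : E -> (R -> E) -> Prop) : Prop :=
  lyapunov_stable sol /\ globally_attractive sol.

Section ClosedLoop.

Variables X U Y : RealHilbert.
Variables (D : X -> Prop) (A f : X -> X) (g : X -> Lin U X).
Variables (S : Lin Y Y) (C h : X -> Y) (M : X -> Y) (dM : X -> Lin X Y).

(* Coquelicot's product norm is sqrt(|x|^2 + |z|^2). *)
Definition state_space : NormedSpace := prod_NormedModule R_AbsRing X Y.

Definition feedback (x : X) (z : Y) : U :=
  adjoint (g x) (adjoint (dM x) (minus z (M x))).

Definition closed_loop_domain (w : state_space) : Prop := D (fst w).

Definition closed_loop_linear (w : state_space) : state_space :=
  (A (fst w), C (fst w)).

Definition closed_loop_nonlinear (w : state_space) : state_space :=
  let (x, z) := w in
  (plus (f x) (g x (feedback x z)), plus (S z) (h x)).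

Definition closed_loop_solution : state_space -> (R -> state_space) -> Prop :=
  is_mild_solution closed_loop_domain closed_loop_linear closed_loop_nonlinear.

End ClosedLoop.

(* Main.v *)
Require Import Defs.
From Stdlib Require Import Reals Lra Lia List Classical IndefiniteDescription.
From Coquelicot Require Import Coquelicot.
Open Scope R_scope.

(** Let [e = z - M x] be the deviation from the invariant graph and
    [q = norm e ^ 2 / 2].  Formally, the invariance of the graph gives
    [e' = S e - dM x (g x u)], so that, [S] being skew-adjoint and [u] being
    [(dM x (g x))^* e], one has [q' = - norm u ^ 2]
    ([trajectory_dini_deviation]).

    Stability.  With [V' <= beta * norm u ^ 2] the function [V + beta * q]
    decreases; it dominates [norm x ^ 2] and [norm e ^ 2], and it vanishes at
    the origin.  In particular [x] stays in a ball [B].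

    Attractivity.  For the functional [V_B] attached to this ball,
    [V_B + b * q] has derivative at most [- alpha * V_B].  Both [q] and
    [V_B + b * q] decrease, so they converge, and so does [V_B]; its limit
    must be zero, since otherwise [V_B + b * q] would become negative
    ([dini_dissipation_lim]).  Hence [x] tends to [0].  As [dM 0 (g 0)] is
    onto, its adjoint is coercive ([surjective_adjoint_coercive]), and by
    continuity [norm u >= c * norm e] as soon as [x] is small
    ([input_map_coercive]).  Then [q' <= - 2 * c ^ 2 * q], and [q] tends to
    [0] for the same reason.

    Mild solutions.  These are in general nowhere in the domain of the
    generator, so the derivatives above do not exist.  They are replaced by
    upper right Dini derivatives, and these can be bounded at every point of
    a mild solution without approximating it by classical ones
    ([dini_le_along_perturbed_flow]).  If [dV y (G y) <= k y] on the domain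
    of the generator [G], with [k] continuous, then
    [V (T h y) - V y <= h * (k x + eps)] for [y] in the domain near [x] and
    [h] small, and the left-hand side is continuous in [y], so that by density
    the domain disappears from the estimate ([flow_growth]).  A mild solution
    satisfies [w (t + h) = T h (w t) + h * phi + o(h)], where [phi] is the
    nonlinear part at [w t] ([mild_solution_increment]), and since [V] is
    continuously differentiable this displacement adds [h * dV x phi + o(h)].  A continuous
    function whose Dini derivative is at most [k] grows at most with slope
    [k] ([dini_growth]), which is all that the argument above requires.

    The semigroup of the closed loop acts on the product space; its bound near
    time zero and the density of its domain come from uniform boundedness and
    from averaging orbits. *)

(** * Linear identities in modules *)

Section LinearIdentities.

Context {E : ModuleSpace R_AbsRing}.

Inductive module_expr : Type :=
| MVar (n : nat)
| MZero
| MPlus (a b : module_expr)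
| MOpp (a : module_expr)
| MScal (k : R) (a : module_expr).

Fixpoint meval (env : list E) (e : module_expr) : E :=
  match e with
  | MVar n => List.nth n env zero
  | MZero => zero
  | MPlus a b => plus (meval env a) (meval env b)
  | MOpp a => opp (meval env a)
  | MScal k a => scal k (meval env a)
  end.

Fixpoint mcoef (e : module_expr) (n : nat) : R :=
  match e with
  | MVar m => if Nat.eqb m n then 1 else 0
  | MZero => 0
  | MPlus a b => mcoef a n + mcoef b n
  | MOpp a => - mcoef a n
  | MScal k a => k * mcoef a n
  end.

Fixpoint lincomb (env : list E) (c : nat -> R) : E :=
  match env with
  | nil => zero
  | cons v l => plus (scal (c O) v) (lincomb l (fun n => c (S n)))
  end.

Lemma lincomb_zero env : lincomb env (fun _ => 0) = zero.
Proof.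
induction env as [|v l IH]; simpl; [reflexivity|].
rewrite IH, plus_zero_r; exact (scal_zero_l v).
Qed.

Lemma lincomb_ext env c c' : (forall n, c n = c' n) -> lincomb env c = lincomb env c'.
Proof.
revert c c'; induction env as [|v l IH]; intros c c' H; simpl; [reflexivity|].
rewrite (H O); f_equal; apply IH; intros n; apply H.
Qed.

Lemma lincomb_plus env c c' :
  lincomb env (fun n => c n + c' n) = plus (lincomb env c) (lincomb env c').
Proof.
revert c c'; induction env as [|v l IH]; intros c c'; simpl.
- now rewrite plus_zero_r.
- rewrite IH.
  replace (scal (c O + c' O) v) with (plus (scal (c O) v) (scal (c' O) v))
    by (symmetry; exact (scal_distr_r (c O) (c' O) v)).
  rewrite <- !plus_assoc; f_equal; rewrite !plus_assoc; f_equal; apply plus_comm.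
Qed.

Lemma lincomb_scal env (k : R) c :
  lincomb env (fun n => k * c n) = scal k (lincomb env c).
Proof.
revert c; induction env as [|v l IH]; intros c; simpl.
- symmetry; exact (scal_zero_r k).
- rewrite IH, (scal_distr_l k); f_equal; symmetry; exact (scal_assoc k (c O) v).
Qed.

Lemma lincomb_var env m :
  lincomb env (fun n => if Nat.eqb m n then 1 else 0) = List.nth m env zero.
Proof.
revert m; induction env as [|v l IH]; intros [|m]; simpl; try reflexivity.
- rewrite (lincomb_zero l), plus_zero_r; exact (scal_one v).
- rewrite (IH m).
  replace (scal 0 v) with (@zero E) by (symmetry; exact (scal_zero_l v)).
  apply plus_zero_l.
Qed.

Lemma meval_lincomb env e : meval env e = lincomb env (mcoef e).
Proof.
induction e as [n| |a IHa b IHb|a IHa|k a IHa]; simpl.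
- symmetry; apply lincomb_var.
- symmetry; apply lincomb_zero.
- now rewrite IHa, IHb, <- lincomb_plus.
- rewrite IHa; replace (opp (lincomb env (mcoef a))) with (scal (-1) (lincomb env (mcoef a)))
    by exact (scal_opp_one _).
  rewrite <- lincomb_scal; apply lincomb_ext; intros n; ring.
- now rewrite IHa, <- lincomb_scal.
Qed.

Fixpoint same_coef (env : list E) (c c' : nat -> R) : Prop :=
  match env with
  | nil => True
  | cons _ l => c O = c' O /\ same_coef l (fun n => c (S n)) (fun n => c' (S n))
  end.

Lemma meval_eq env a b : same_coef env (mcoef a) (mcoef b) -> meval env a = meval env b.
Proof.
rewrite !meval_lincomb; generalize (mcoef a) (mcoef b).
induction env as [|v l IH]; intros c c' H; simpl in *; [reflexivity|].
destruct H as [-> H]; f_equal; now apply IH.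
Qed.

End LinearIdentities.

Ltac module_find x l :=
  match l with
  | cons ?y _ => let _ := match constr:(O) with _ => unify x y end in constr:(Some O)
  | cons _ ?l' => let r := module_find x l' in
                  match r with
                  | Some ?n => constr:(Some (S n))
                  | None => constr:(@None nat)
                  end
  | nil => constr:(@None nat)
  end.

Ltac module_atoms E t l :=
  match t with
  | plus ?a ?b => let l1 := module_atoms E a l in module_atoms E b l1
  | minus ?a ?b => let l1 := module_atoms E a l in module_atoms E b l1
  | opp ?a => module_atoms E a l
  | scal _ ?a => module_atoms E a l
  | zero => l
  | _ => let r := module_find t l in
         match r with
         | Some _ => l
         | None => constr:(@cons E t l)
         end
  end.

Ltac module_reify t l :=
  match t with
  | plus ?a ?b => let ra := module_reify a l in let rb := module_reify b l in
                  constr:(MPlus ra rb)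
  | minus ?a ?b => let ra := module_reify a l in let rb := module_reify b l in
                   constr:(MPlus ra (MOpp rb))
  | opp ?a => let ra := module_reify a l in constr:(MOpp ra)
  | scal ?k ?a => let ra := module_reify a l in constr:(MScal k ra)
  | zero => constr:(MZero)
  | _ => let r := module_find t l in
         match r with Some ?n => constr:(MVar n) end
  end.

(** Proves an equality of linear combinations in the module [E] by comparing
    the real coefficients of each of its atoms. *)
Ltac module_eq E :=
  match goal with
  | |- ?a = ?b =>
      let l := module_atoms E a (@nil E) in
      let l := module_atoms E b l in
      let ra := module_reify a l in
      let rb := module_reify b l in
      change (@meval E l ra = @meval E l rb);
      apply meval_eq; cbn [same_coef mcoef Nat.eqb]; repeat split;
      try (field; lra); try ring
  end.

(** * Norm estimates *)

Lemma norm_minus_sym (E : NormedSpace) (x y : E) : norm (minus x y) = norm (minus y x).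
Proof. rewrite <- norm_opp; f_equal; apply opp_minus. Qed.

Lemma norm_minus_triangle (E : NormedSpace) (x y z : E) :
  norm (minus x z) <= norm (minus x y) + norm (minus y z).
Proof.
replace (minus x z) with (plus (minus x y) (minus y z)) by module_eq E.
exact (norm_triangle (minus x y) (minus y z)).
Qed.

Lemma norm_scal_le (E : NormedSpace) (k b : R) (x : E) :
  0 <= k -> norm x <= b -> norm (scal k x) <= k * b.
Proof.
intros Hk Hx; rewrite norm_scal_R, Rabs_pos_eq by exact Hk.
now apply Rmult_le_compat_l.
Qed.

Lemma norm_le_minus (E : NormedSpace) (x y : E) : norm x <= norm (minus x y) + norm y.
Proof.
replace (norm x) with (norm (plus (minus x y) y)) by (f_equal; module_eq E).
exact (norm_triangle (minus x y) y).
Qed.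

Lemma norm_minus_le (E : NormedSpace) (x y : E) (a b : R) :
  norm x <= a -> norm y <= b -> norm (minus x y) <= a + b.
Proof.
intros Hx Hy; apply Rle_trans with (1 := norm_triangle x (opp y)).
rewrite norm_opp; lra.
Qed.

Lemma norm_minus_self (E : NormedSpace) (x : E) : norm (minus x x) = 0.
Proof.
apply eq_trans with (norm (zero : E)); [f_equal; module_eq E|exact norm_zero].
Qed.

Lemma Rle_of_le_eps (a b : R) : (forall e, 0 < e -> a <= b + e) -> a <= b.
Proof.
intros H; destruct (Rle_lt_dec a b) as [Hab|Hab]; [exact Hab|].
specialize (H ((a - b) / 2)); lra.
Qed.

Lemma filterlim_norm_iff {T : Type} (E : NormedSpace) (F : (T -> Prop) -> Prop) {FF : Filter F}
    (f : T -> E) (y : E) :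
  filterlim f F (locally y) <-> forall e, 0 < e -> F (fun x => norm (minus (f x) y) < e).
Proof.
rewrite filterlim_locally_ball_norm; split.
- intros H e He; exact (H (mkposreal e He)).
- intros H e; exact (H e (cond_pos e)).
Qed.

Lemma locally_norm_iff (E : NormedSpace) (x : E) (P : E -> Prop) :
  locally x P <-> exists d, 0 < d /\ forall y, norm (minus y x) < d -> P y.
Proof.
split.
- intros H; destruct (locally_norm_le_locally x P H) as [d Hd].
  exists d; split; [apply cond_pos|exact Hd].
- intros [d [Hd H]]; apply (locally_le_locally_norm x P).
  now exists (mkposreal d Hd).
Qed.

Lemma continuous_norm_iff (E F : NormedSpace) (f : E -> F) (x : E) :
  continuous f x <->
  forall e, 0 < e -> exists d, 0 < d /\
    forall y, norm (minus y x) < d -> norm (minus (f y) (f x)) < e.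
Proof.
unfold continuous; rewrite (filterlim_norm_iff F (locally x)); split; intros H e He;
  now apply locally_norm_iff, H.
Qed.

Lemma at_right_0_iff (P : R -> Prop) :
  at_right 0 P <-> exists d, 0 < d /\ forall t, 0 < t < d -> P t.
Proof.
split.
- intros [d Hd]; exists d; split; [apply cond_pos|]; intros t Ht; apply Hd; [|lra].
  change (Rabs (t - 0) < d); rewrite Rabs_pos_eq; lra.
- intros [d [Hd H]]; exists (mkposreal d Hd); intros t Ht Ht0; apply H.
  change (Rabs (t - 0) < d) in Ht; apply Rabs_def2 in Ht; lra.
Qed.

Lemma within_locally_R_iff (D P : R -> Prop) (t : R) :
  within D (locally t) P <->
  exists d, 0 < d /\ forall s, D s -> Rabs (s - t) < d -> P s.
Proof.
split.
- intros [d Hd]; exists d; split; [apply cond_pos|]; intros s Ds Hs; now apply Hd.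
- intros [d [Hd H]]; exists (mkposreal d Hd); intros s Hs Ds; now apply H.
Qed.

Lemma continuous_on_R_norm_iff (E : NormedSpace) (D : R -> Prop) (w : R -> E) :
  continuous_on D w <->
  forall t, D t -> forall e, 0 < e -> exists d, 0 < d /\
    forall s, D s -> Rabs (s - t) < d -> norm (minus (w s) (w t)) < e.
Proof.
unfold continuous_on; split; intros H t Dt.
- intros e He; apply within_locally_R_iff.
  exact (proj1 (filterlim_norm_iff E (within D (locally t)) w (w t)) (H t Dt) e He).
- apply (filterlim_norm_iff E (within D (locally t))).
  intros e He; apply within_locally_R_iff; now apply H.
Qed.

Lemma continuous_on_postcomp (E : UniformSpace) (F : UniformSpace) (D : R -> Prop)
    (w : R -> E) (f : E -> F) :
  continuous_on D w -> (forall x, continuous f x) -> continuous_on D (fun t => f (w t)).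
Proof.
intros Hw Hf t Dt.
apply filterlim_comp with (1 := Hw t Dt); apply Hf.
Qed.

(** * Dini derivatives *)

(** The upper right Dini derivative of [F] at [t] is at most [k]. *)
Definition dini_le (F : R -> R) (t k : R) : Prop :=
  forall e, 0 < e -> exists d, 0 < d /\
    forall h, 0 < h < d -> F (t + h) - F t <= (k + e) * h.

Lemma dini_le_weaken F t k k' : k <= k' -> dini_le F t k -> dini_le F t k'.
Proof.
intros Hk H e He; destruct (H e He) as [d [Hd Hh]]; exists d; split; [exact Hd|].
intros h Hh'; apply Rle_trans with (1 := Hh h Hh'); nra.
Qed.

Lemma dini_le_plus F G t k l :
  dini_le F t k -> dini_le G t l -> dini_le (fun s => F s + G s) t (k + l).
Proof.
intros HF HG e He.
destruct (HF (e / 2)) as [d [Hd H]]; [lra|].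
destruct (HG (e / 2)) as [d' [Hd' H']]; [lra|].
exists (Rmin d d'); split; [now apply Rmin_pos|]; intros h Hh.
generalize (Rmin_l d d') (Rmin_r d d'); intros.
specialize (H h); specialize (H' h); nra.
Qed.

Lemma dini_le_scal c F t k :
  0 < c -> dini_le F t k -> dini_le (fun s => c * F s) t (c * k).
Proof.
intros Hc HF e He.
destruct (HF (e / c)) as [d [Hd H]]; [now apply Rdiv_lt_0_compat|].
exists d; split; [exact Hd|]; intros h Hh; specialize (H h Hh).
apply (Rmult_le_compat_l c) in H; [|lra].
replace ((c * k + e) * h) with (c * ((k + e / c) * h)) by (field; lra); lra.
Qed.

(** The supremum of the times up to which the bound with slope [k + e] holds
    is reached by continuity and cannot lie before [b], since the Dini bound
    carries the estimate a little further. *)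
Lemma dini_growth (F : R -> R) (a b k : R) :
  a <= b -> continuous_on (fun t => a <= t <= b) F ->
  (forall t, a <= t < b -> dini_le F t k) -> F b - F a <= k * (b - a).
Proof.
intros Hab Hc Hd.
assert (Hc' := proj1 (continuous_on_R_norm_iff R_NormedModule _ F) Hc).
assert (main : forall e, 0 < e -> F b - F a <= (k + e) * (b - a)).
{ intros e He.
  set (P := fun t => a <= t <= b /\ forall s, a <= s <= t -> F s - F a <= (k + e) * (s - a)).
  assert (Pa : P a).
  { split; [lra|]; intros s Hs; replace s with a by lra; lra. }
  destruct (completeness P) as [c [Hc1 Hc2]].
  { exists b; intros t [Ht _]; lra. }
  { now exists a. }
  assert (Hac : a <= c) by (apply Hc1, Pa).
  assert (Hcb : c <= b) by (apply Hc2; intros t [Ht _]; lra).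
  assert (before : forall s, a <= s < c -> F s - F a <= (k + e) * (s - a)).
  { intros s Hs; destruct (classic (exists t, P t /\ s < t)) as [[t [[_ Pt] Hst]]|N].
    - apply Pt; lra.
    - exfalso; assert (c <= s); [|lra].
      apply Hc2; intros t Pt; destruct (Rle_lt_dec t s); [assumption|].
      exfalso; apply N; now exists t. }
  assert (Pc : P c).
  { split; [lra|]; intros s Hs.
    destruct (Rlt_le_dec s c) as [Hsc|Hsc]; [apply before; lra|].
    replace s with c by lra; clear s Hs Hsc.
    destruct (Req_dec a c) as [<-|Hne]; [lra|].
    apply Rle_of_le_eps; intros r Hr.
    destruct (Hc' c (conj Hac Hcb) (r / 2)) as [d [Hd0 Hd1]]; [lra|].
    set (m := Rmin d (Rmin (c - a) (r / (2 * (Rabs (k + e) + 1))))).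
    assert (HA := Rabs_pos (k + e)).
    assert (Hm : 0 < m).
    { repeat apply Rmin_pos; try lra; apply Rdiv_lt_0_compat; lra. }
    assert (Hm1 : m <= d) by apply Rmin_l.
    assert (Hm2 : m <= c - a) by (eapply Rle_trans; [apply Rmin_r|apply Rmin_l]).
    assert (Hm3 : m * (Rabs (k + e) + 1) <= r / 2).
    { assert (m <= r / (2 * (Rabs (k + e) + 1)))
        by (eapply Rle_trans; [apply Rmin_r|apply Rmin_r]).
      apply Rle_trans with (r / (2 * (Rabs (k + e) + 1)) * (Rabs (k + e) + 1));
        [apply Rmult_le_compat_r; lra|right; field; lra]. }
    specialize (Hd1 (c - m / 2)); specialize (before (c - m / 2)).
    change (a <= c - m / 2 <= b -> Rabs (c - m / 2 - c) < d ->
            Rabs (F (c - m / 2) - F c) < r / 2) in Hd1.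
    replace (c - m / 2 - c) with (- (m / 2)) in Hd1 by ring.
    rewrite Rabs_Ropp, Rabs_pos_eq in Hd1 by lra.
    assert (Hq := Rabs_def2 _ _ (Hd1 ltac:(lra) ltac:(lra))).
    assert (Hk := Rle_abs (- (k + e))); rewrite Rabs_Ropp in Hk.
    assert (- (k + e) * (m / 2) <= Rabs (k + e) * (m / 2))
      by (apply Rmult_le_compat_r; lra).
    specialize (before ltac:(lra)); nra. }
  destruct (Req_dec c b) as [<-|Hne].
  - destruct Pc as [_ Pc]; apply Pc; lra.
  - exfalso.
    destruct (Hd c ltac:(lra) e He) as [d [Hd0 Hd1]].
    set (m := Rmin d (b - c)).
    assert (Hm : 0 < m) by (apply Rmin_pos; lra).
    assert (Hm1 : m <= d) by apply Rmin_l.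
    assert (Hm2 : m <= b - c) by apply Rmin_r.
    assert (c + m / 2 <= c); [|lra].
    apply Hc1; split; [lra|]; intros s Hs.
    destruct Pc as [_ Pc].
    destruct (Rle_lt_dec s c) as [Hsc|Hsc]; [apply Pc; lra|].
    assert (H1 := Pc c ltac:(lra)); assert (H2 := Hd1 (s - c) ltac:(lra)).
    replace (c + (s - c)) with s in H2 by ring; lra. }
apply Rle_of_le_eps; intros e He.
assert (Hm := main (e / (b - a + 1)) ltac:(apply Rdiv_lt_0_compat; lra)).
assert (e / (b - a + 1) * (b - a) <= e).
{ apply Rle_trans with (e / (b - a + 1) * (b - a + 1)).
  - apply Rmult_le_compat_l; [|lra]; left; apply Rdiv_lt_0_compat; lra.
  - right; field; lra. }
lra.
Qed.

(** * Strict differentiability *)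

(** Strict differentiability lets both points move, as is needed to compare
    [V] at the two moving points [T h x] and [w (t + h)]. *)
Definition strict_diff {E F : NormedSpace} (f : E -> F) (x : E) (L : E -> F) : Prop :=
  forall e, 0 < e -> exists d, 0 < d /\
    forall a b, norm (minus a x) < d -> norm (minus b x) < d ->
      norm (minus (minus (f a) (f b)) (L (minus a b))) <= e * norm (minus a b).

Lemma filterdiff_increment (E F : NormedSpace) (f : E -> F) (x : E) (L : Lin E F) :
  filterdiff f (locally x) L ->
  forall e, 0 < e -> exists d, 0 < d /\
    forall y, norm (minus y x) < d ->
      norm (minus (minus (f y) (f x)) (L (minus y x))) <= e * norm (minus y x).
Proof.
intros [_ H] e He.
apply locally_norm_iff.
exact (H x (fun P HP => HP) (mkposreal e He)).
Qed.

Lemma lin_minus (E F : NormedSpace) (L : Lin E F) (x y : E) :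
  L (minus x y) = minus (L x) (L y).
Proof.
unfold minus; rewrite (linear_plus _ (lin_linear L)).
now rewrite (linear_opp _ _ (lin_linear L)).
Qed.

Lemma lin_plus (E F : NormedSpace) (L : Lin E F) (x y : E) :
  L (plus x y) = plus (L x) (L y).
Proof. exact (linear_plus _ (lin_linear L) x y). Qed.

Lemma lin_scal (E F : NormedSpace) (L : Lin E F) (k : R) (x : E) :
  L (scal k x) = scal k (L x).
Proof. exact (linear_scal _ (lin_linear L) k x). Qed.

Lemma lin_continuous (E F : NormedSpace) (L : Lin E F) (x : E) : continuous L x.
Proof. apply linear_cont, lin_linear. Qed.

Lemma lin_bound_minus (E F : NormedSpace) (L1 L2 : Lin E F) (v : E) :
  norm (minus (L1 v) (L2 v)) <= norm (minus L1 L2) * norm v.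
Proof. exact (opnorm_bound (minus L1 L2) v). Qed.

(** The mean value inequality, in the form that the defect
    [norm (f (b + s (a - b)) - f b - s L (a - b))] grows in [s] at a rate
    controlled by the oscillation of the differential. *)
Lemma C1_strict_diff (E F : NormedSpace) (f : E -> F) (df : E -> Lin E F) (x : E) :
  is_C1 f df -> strict_diff f x (df x).
Proof.
intros [Hf Hc] e He.
destruct (proj1 (continuous_norm_iff _ _ df x) (Hc x) e He) as [d [Hd H]].
exists d; split; [exact Hd|]; intros a b Ha Hb.
set (L := df x); set (v := minus a b).
set (g := fun s : R => plus b (scal s v)).
set (G := fun s => norm (minus (minus (f (g s)) (f b)) (scal s (L v)))).
assert (gball : forall s, 0 <= s <= 1 -> norm (minus (g s) x) < d).
{ intros s Hs.
  replace (minus (g s) x) with (plus (scal s (minus a x)) (scal (1 - s) (minus b x)))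
    by (unfold g, v; module_eq E).
  apply Rle_lt_trans with (1 := norm_triangle (scal s (minus a x)) (scal (1 - s) (minus b x))).
  rewrite !norm_scal_R, !Rabs_pos_eq by lra.
  destruct (Req_dec s 0) as [->|Hs0]; [lra|].
  assert (s * norm (minus a x) < s * d) by (apply Rmult_lt_compat_l; lra).
  assert ((1 - s) * norm (minus b x) <= (1 - s) * d) by (apply Rmult_le_compat_l; lra).
  lra. }
assert (gincr : forall s r, minus (g r) (g s) = scal (r - s) v)
  by (intros s r; unfold g; module_eq E).
assert (loc : forall s r, 0 < r -> exists m, 0 < m /\ forall t, Rabs (t - s) < m ->
  norm (minus (minus (f (g t)) (f (g s))) (scal (t - s) (df (g s) v))) <= r * Rabs (t - s)).
{ intros s r Hr.
  assert (Hv := norm_ge_0 v).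
  destruct (filterdiff_increment _ _ f (g s) (df (g s)) (Hf (g s)) (r / (norm v + 1)))
    as [m [Hm0 Hm]]; [apply Rdiv_lt_0_compat; lra|].
  exists (m / (norm v + 1)); split; [apply Rdiv_lt_0_compat; lra|]; intros t Ht.
  specialize (Hm (g t)); rewrite gincr, norm_scal_R, lin_scal in Hm.
  apply Rle_trans with (r / (norm v + 1) * (Rabs (t - s) * norm v)).
  - apply Hm.
    apply Rle_lt_trans with (Rabs (t - s) * (norm v + 1));
      [apply Rmult_le_compat_l; [apply Rabs_pos|lra]|].
    apply Rlt_le_trans with (m / (norm v + 1) * (norm v + 1));
      [apply Rmult_lt_compat_r; lra|right; field; lra].
  - replace (r * Rabs (t - s)) with (r / (norm v + 1) * (Rabs (t - s) * (norm v + 1)))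
      by (field; lra).
    apply Rmult_le_compat_l; [left; apply Rdiv_lt_0_compat; lra|].
    apply Rmult_le_compat_l; [apply Rabs_pos|lra]. }
assert (osc : forall s, 0 <= s <= 1 -> norm (minus (df (g s) v) (L v)) <= e * norm v).
{ intros s Hs; apply Rle_trans with (1 := lin_bound_minus _ _ _ _ _).
  apply Rmult_le_compat_r; [apply norm_ge_0|]; left; now apply H, gball. }
assert (step : forall s r, 0 <= s <= 1 -> 0 < r -> exists m, 0 < m /\ forall t, Rabs (t - s) < m ->
  norm (minus (minus (f (g t)) (f (g s))) (scal (t - s) (L v))) <= (e * norm v + r) * Rabs (t - s)).
{ intros s r Hs Hr; destruct (loc s r Hr) as [m [Hm0 Hm]].
  exists m; split; [exact Hm0|]; intros t Ht; specialize (Hm t Ht).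
  replace (minus (minus (f (g t)) (f (g s))) (scal (t - s) (L v)))
    with (plus (minus (minus (f (g t)) (f (g s))) (scal (t - s) (df (g s) v)))
               (scal (t - s) (minus (df (g s) v) (L v)))) by module_eq F.
  eapply Rle_trans; [apply norm_triangle|].
  rewrite norm_scal_R.
  assert (Rabs (t - s) * norm (minus (df (g s) v) (L v)) <= Rabs (t - s) * (e * norm v))
    by (apply Rmult_le_compat_l; [apply Rabs_pos|now apply osc]).
  lra. }
assert (Gincr : forall s t, Rabs (G t - G s) <=
  norm (minus (minus (f (g t)) (f (g s))) (scal (t - s) (L v)))).
{ intros s t; unfold G.
  set (p := minus (minus (f (g t)) (f b)) (scal t (L v))).
  set (q := minus (minus (f (g s)) (f b)) (scal s (L v))).
  replace (minus (minus (f (g t)) (f (g s))) (scal (t - s) (L v))) with (minus p q)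
    by (unfold p, q; module_eq F).
  generalize (norm_le_minus _ p q) (norm_le_minus _ q p).
  rewrite (norm_minus_sym _ q p); intros; apply Rabs_le; lra. }
assert (HG : G 1 - G 0 <= (e * norm v) * (1 - 0)).
{ apply dini_growth; [lra| |].
  - apply (continuous_on_R_norm_iff R_NormedModule); intros s Hs r Hr.
    destruct (step s 1 Hs ltac:(lra)) as [m [Hm0 Hm]].
    assert (Hv : 0 <= e * norm v) by (apply Rmult_le_pos; [lra|apply norm_ge_0]).
    exists (Rmin m (r / (e * norm v + 1))); split.
    + apply Rmin_pos; [lra|apply Rdiv_lt_0_compat; lra].
    + intros t Ht Hts; change (Rabs (G t - G s) < r).
      apply Rle_lt_trans with (1 := Gincr s t).
      assert (Hts1 := Rlt_le_trans _ _ _ Hts (Rmin_l _ _)).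
      assert (Hts2 := Rlt_le_trans _ _ _ Hts (Rmin_r _ _)).
      apply Rle_lt_trans with (1 := Hm t Hts1).
      apply Rlt_le_trans with ((e * norm v + 1) * (r / (e * norm v + 1)));
        [apply Rmult_lt_compat_l; lra|right; field; lra].
  - intros s Hs r Hr; destruct (step s r ltac:(lra) Hr) as [m [Hm0 Hm]].
    exists m; split; [exact Hm0|]; intros h Hh.
    assert (Hh' : Rabs (s + h - s) = h)
      by (replace (s + h - s) with h by ring; apply Rabs_pos_eq; lra).
    specialize (Hm (s + h)); rewrite Hh' in Hm.
    apply Rle_trans with (1 := Rle_abs _), Rle_trans with (1 := Gincr s (s + h)).
    apply Hm; lra. }
assert (G0 : G 0 = 0).
{ unfold G; replace (g 0) with b by (unfold g; module_eq E).
  apply eq_trans with (norm (zero : F)); [f_equal; module_eq F|exact norm_zero]. }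
assert (G1 : G 1 = norm (minus (minus (f a) (f b)) (L v))).
{ unfold G; f_equal; replace (g 1) with a by (unfold g, v; module_eq E); module_eq F. }
rewrite <- G1; lra.
Qed.

Lemma strict_diff_continuous (E F : NormedSpace) (f : E -> F) (x : E) (L : E -> F) :
  is_linear L -> strict_diff f x L -> continuous f x.
Proof.
intros HL Hf; apply continuous_norm_iff; intros e He.
destruct (Hf 1 ltac:(lra)) as [d [Hd H]].
set (K := norm (mkLin HL : Lin E F)).
assert (HK : 0 <= K) by apply norm_ge_0.
exists (Rmin d (e / (K + 1))); split; [apply Rmin_pos; [lra|apply Rdiv_lt_0_compat; lra]|].
intros y Hy.
assert (Hy1 := Rlt_le_trans _ _ _ Hy (Rmin_l _ _)).
assert (Hy2 := Rlt_le_trans _ _ _ Hy (Rmin_r _ _)).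
assert (Hx : norm (minus x x) < d) by (rewrite norm_minus_self; lra).
specialize (H y x Hy1 Hx).
assert (Hb : norm (L (minus y x)) <= K * norm (minus y x))
  by exact (opnorm_bound (mkLin HL) (minus y x)).
generalize (norm_le_minus _ (minus (f y) (f x)) (L (minus y x))); intros Ht.
apply Rle_lt_trans with ((K + 1) * norm (minus y x)); [lra|].
apply Rlt_le_trans with ((K + 1) * (e / (K + 1)));
  [apply Rmult_lt_compat_l; lra|right; field; lra].
Qed.

Lemma C1_continuous (E F : NormedSpace) (f : E -> F) (df : E -> Lin E F) (x : E) :
  is_C1 f df -> continuous f x.
Proof.
intros H; apply strict_diff_continuous with (1 := lin_linear (df x)).
exact (C1_strict_diff _ _ _ _ _ H).
Qed.

(** * Uniform boundedness *)

(** Completeness as a hypothesis on a normed space, rather than as a structure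
    of its own, keeps the algebraic operations those of the normed space. *)
Definition banach (E : NormedSpace) : Type := CompleteSpace.mixin_of E.

Definition complete_module (E : NormedSpace) (cE : banach E) :
    CompleteNormedModule R_AbsRing :=
  CompleteNormedModule.Pack R_AbsRing E
    (CompleteNormedModule.Class R_AbsRing E (NormedModule.class R_AbsRing E) cE) E.

Definition hilbert_banach (H : RealHilbert) : banach H :=
  CompleteNormedModule.mixin _ _ (CompleteNormedModule.class R_AbsRing H).

Definition prod_banach (E F : NormedSpace) (cE : banach E) (cF : banach F) :
  banach (prod_NormedModule R_AbsRing E F).
Proof.
apply (CompleteSpace.Mixin (prod_NormedModule R_AbsRing E F)
  (fun Fi => (@lim (complete_module E cE) (filtermap (fun p : E * F => fst p) Fi),
              @lim (complete_module F cF) (filtermap (fun p : E * F => snd p) Fi)))).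
- intros Fi PF HC e.
  assert (C1 : @cauchy (complete_module E cE) (filtermap (fun p : E * F => fst p) Fi)).
  { intros r; destruct (HC r) as [p Hp]; exists (fst p).
    unfold filtermap; revert Hp; apply filter_imp; now intros q [Hq _]. }
  assert (C2 : @cauchy (complete_module F cF) (filtermap (fun p : E * F => snd p) Fi)).
  { intros r; destruct (HC r) as [p Hp]; exists (snd p).
    unfold filtermap; revert Hp; apply filter_imp; now intros q [_ Hq]. }
  generalize (complete_cauchy _ (filtermap_proper_filter _ _ _ _ PF) C1 e)
             (complete_cauchy _ (filtermap_proper_filter _ _ _ _ PF) C2 e).
  unfold filtermap; intros H1 H2.
  generalize (filter_and _ _ H1 H2); apply filter_imp; intros q Hq; exact Hq.
- intros F1 F2 H1 H2 e; split; simpl.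
  + apply (@close_lim (complete_module E cE)); intros P HP; [now apply H1|now apply H2].
  + apply (@close_lim (complete_module F cF)); intros P HP; [now apply H1|now apply H2].
Defined.

Lemma cauchy_seq_converges (E : NormedSpace) (cE : banach E) (u : nat -> E) :
  (forall e, 0 < e -> exists N, forall m n, (N <= m)%nat -> (N <= n)%nat ->
    norm (minus (u m) (u n)) < e) ->
  exists l, filterlim u eventually (locally l).
Proof.
intros H.
set (Fi := filtermap u eventually).
assert (PF : ProperFilter Fi) by (apply filtermap_proper_filter, eventually_filter).
assert (Hc : cauchy Fi).
{ intros e; destruct (H e (cond_pos e)) as [N HN].
  exists (u N), N; intros n Hn; apply (norm_compat1 (u N) (u n)); now apply HN. }
exists (@lim (complete_module E cE) Fi); apply filterlim_locally; intros e.
exact (@complete_cauchy (complete_module E cE) Fi PF Hc e).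
Qed.

Lemma opnorm_almost_attained (E F : NormedSpace) (L : Lin E F) :
  0 < opnorm L -> exists v, norm v <= 1 /\ 3 / 4 * opnorm L <= norm (L v).
Proof.
intros HL; apply NNPP; intros N.
assert (opnorm L <= 3 / 4 * opnorm L); [|lra].
apply opnorm_le; [lra|]; intros x.
destruct (Req_dec (norm x) 0) as [H0|H0].
- generalize (opnorm_bound L x); rewrite H0; lra.
- assert (Hx : 0 < norm x) by (generalize (norm_ge_0 x); lra).
  destruct (Rle_lt_dec (norm (L x)) (3 / 4 * opnorm L * norm x)) as [H|H]; [exact H|].
  exfalso; apply N; exists (scal (/ norm x) x).
  rewrite lin_scal, !norm_scal_R, Rabs_pos_eq by (left; now apply Rinv_0_lt_compat).
  split; [right; field; lra|].
  apply Rmult_le_reg_r with (norm x); [exact Hx|].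
  replace (/ norm x * norm (L x) * norm x) with (norm (L x)) by (field; lra); lra.
Qed.

(** Moving by [r] in the direction of [v] or of [- v]: the two images differ by [2 r L v], so
    one of them is at least as large as [r L v]. *)
Lemma lin_large_nearby (E F : NormedSpace) (L : Lin E F) (x : E) (r : R) :
  0 < r -> exists y, norm (minus y x) <= r /\ 3 / 4 * (r * opnorm L) <= norm (L y).
Proof.
intros Hr.
destruct (Rle_lt_dec (opnorm L) 0) as [H0|H0].
{ exists x; rewrite norm_minus_self; split; [lra|].
  generalize (norm_ge_0 (L x)); nra. }
destruct (opnorm_almost_attained _ _ L H0) as [v [Hv HLv]].
assert (H2 : 2 * (r * norm (L v)) <=
  norm (L (plus x (scal r v))) + norm (L (minus x (scal r v)))).
{ replace (2 * (r * norm (L v))) with (norm (scal (2 * r) (L v)))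
    by (rewrite norm_scal_R, Rabs_pos_eq; lra).
  replace (scal (2 * r) (L v))
    with (minus (L (plus x (scal r v))) (L (minus x (scal r v)))).
  2: { rewrite lin_minus, lin_plus, lin_scal; module_eq F. }
  rewrite <- (norm_opp (L (minus x (scal r v)))).
  exact (norm_triangle (L (plus x (scal r v))) (opp (L (minus x (scal r v))))). }
assert (Hrv : norm (scal r v) <= r) by (rewrite norm_scal_R, Rabs_pos_eq; nra).
assert (3 / 4 * (r * opnorm L) <= r * norm (L v)) by nra.
destruct (Rle_lt_dec (r * norm (L v)) (norm (L (plus x (scal r v))))) as [Hc|Hc].
- exists (plus x (scal r v)); split; [|lra].
  replace (minus (plus x (scal r v)) x) with (scal r v) by module_eq E; exact Hrv.
- exists (minus x (scal r v)); split; [|lra].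
  replace (minus (minus x (scal r v)) x) with (opp (scal r v)) by module_eq E.
  apply Rle_trans with (2 := Hrv), Req_le; exact (norm_opp (V := E) (scal r v)).
Qed.

(** The uniform boundedness principle.  The point [x] is the limit of a
    sequence whose [n]-th step has length [3^-n] and makes [L n] large; all
    later steps together are shorter by a factor [2], so they cannot undo
    this. *)
Lemma uniform_boundedness (E F : NormedSpace) (cE : banach E)   (L : nat -> Lin E F) :
  (forall n, 4 ^ n <= opnorm (L n)) ->
  exists x, filterlim (fun n => norm (L n x)) eventually (Rbar_locally p_infty).
Proof.
intros HL.
assert (p3 : forall n, 0 < / 3 ^ n) by (intros n; apply Rinv_0_lt_compat, pow_lt; lra).
destruct (functional_choice (fun (p : nat * E) (y : E) => norm (minus y (snd p)) <= / 3 ^ fst p /\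
   3 / 4 * (/ 3 ^ fst p * opnorm (L (fst p))) <= norm (L (fst p) y)))
  as [step Hstep].
{ intros [n x]; exact (lin_large_nearby _ _ (L n) x (/ 3 ^ n) (p3 n)). }
set (u := fix u (n : nat) : E := match n with O => step (O, zero : E) | S m => step (S m, u m) end).
assert (Hu1 : forall n, norm (minus (u (S n)) (u n)) <= / 3 ^ S n)
  by (intros n; exact (proj1 (Hstep (S n, u n)))).
assert (Hu2 : forall n, 3 / 4 * (/ 3 ^ n * opnorm (L n)) <= norm (L n (u n)))
  by (intros [|n]; [exact (proj2 (Hstep (O, zero : E)))|exact (proj2 (Hstep (S n, u n)))]).
assert (Hu3 : forall n k, norm (minus (u (n + k)%nat) (u n)) <= / 2 * (/ 3 ^ n - / 3 ^ (n + k))).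
{ intros n k; induction k as [|k IH].
  - rewrite Nat.add_0_r, norm_minus_self.
    generalize (/ 3 ^ n); intros; lra.
  - eapply Rle_trans; [apply norm_minus_triangle with (y := u (n + k)%nat)|].
    rewrite Nat.add_succ_r; generalize (Hu1 (n + k)%nat); simpl pow.
    rewrite Rinv_mult; lra. }
assert (Hu4 : forall n m, (n <= m)%nat -> norm (minus (u m) (u n)) <= / 2 * / 3 ^ n).
{ intros n m Hm; replace m with (n + (m - n))%nat by lia.
  generalize (Hu3 n (m - n)%nat) (p3 (n + (m - n))%nat); lra. }
destruct (cauchy_seq_converges E cE u) as [x Hx].
{ intros e He.
  destruct (pow_lt_1_zero (/ 3) ltac:(rewrite Rabs_pos_eq; lra) e He) as [N HN].
  exists N; intros m n Hm Hn.
  eapply Rle_lt_trans; [apply norm_minus_triangle with (y := u N)|].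
  rewrite (norm_minus_sym _ (u N)).
  assert (HN' := HN N ltac:(lia)); rewrite pow_inv in HN'.
  rewrite Rabs_pos_eq in HN' by (left; apply p3).
  generalize (Hu4 N m Hm) (Hu4 N n Hn); lra. }
assert (Hxn : forall n, norm (minus x (u n)) <= / 2 * / 3 ^ n).
{ intros n; apply Rle_of_le_eps; intros e He.
  destruct (proj1 (filterlim_norm_iff E eventually u x) Hx e He) as [N HN].
  specialize (HN (Nat.max N n) ltac:(lia)).
  rewrite norm_minus_sym in HN.
  eapply Rle_trans; [apply norm_minus_triangle with (y := u (Nat.max N n))|].
  generalize (Hu4 n (Nat.max N n) ltac:(lia)); lra. }
exists x.
assert (Hbig : forall n, / 4 * (4 / 3) ^ n <= norm (L n x)).
{ intros n.
  assert (H1 := norm_le_minus _ (L n (u n)) (L n x)).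
  rewrite <- lin_minus in H1.
  assert (H2 := opnorm_bound (L n) (minus (u n) x)).
  rewrite norm_minus_sym in H2.
  assert (H3 : opnorm (L n) * norm (minus x (u n)) <= opnorm (L n) * (/ 2 * / 3 ^ n))
    by (apply Rmult_le_compat_l; [apply opnorm_ge0|apply Hxn]).
  assert (H4 : / 3 ^ n * 4 ^ n <= / 3 ^ n * opnorm (L n))
    by (apply Rmult_le_compat_l; [left; apply p3|apply HL]).
  replace ((4 / 3) ^ n) with (/ 3 ^ n * 4 ^ n)
    by (unfold Rdiv; rewrite Rpow_mult_distr, pow_inv; ring).
  generalize (Hu2 n); lra. }
intros P [K HP].
destruct (Pow_x_infinity (4 / 3) ltac:(rewrite Rabs_pos_eq; lra) (4 * (K + 1))) as [N HN].
exists N; intros n Hn; apply HP.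
specialize (HN n Hn); rewrite Rabs_pos_eq in HN by (apply pow_le; lra).
generalize (Hbig n); lra.
Qed.

Lemma inner_is_linear (H : RealHilbert) (y : H) :
  is_linear (K := R_AbsRing) (U := H) (V := R_NormedModule) (fun x => inner x y).
Proof.
split.
- intros x x'; apply inner_plus_l.
- intros k x; apply inner_scal_l.
- exists (norm y + 1); generalize (norm_ge_0 y); intros Hy; split; [lra|]; intros x.
  change (Rabs (inner x y) <= (norm y + 1) * norm x).
  generalize (inner_Cauchy_Schwarz x y) (norm_ge_0 x); nra.
Qed.

(** The functionals [<., y>] with [norm (adjoint N y) <= 1] are pointwise
    bounded, because every vector of [Y] is of the form [N u]; by uniform
    boundedness the vectors [y] are bounded. *)
Lemma surjective_adjoint_coercive (U Y : RealHilbert) (N : Lin U Y) :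
  (forall y, exists u, N u = y) ->
  exists K, 0 < K /\ forall y, norm y <= K * norm (adjoint N y).
Proof.
intros Hsurj; apply NNPP; intros HK.
assert (Hy : forall n : nat, exists w : Y, 4 ^ n <= norm w /\ norm (adjoint N w) <= 1).
{ intros n; apply NNPP; intros Hn; apply HK.
  exists (4 ^ n); split; [apply pow_lt; lra|]; intros y.
  apply Rnot_lt_le; intros Hlt; apply Hn.
  set (a := norm (adjoint N y)) in *.
  assert (Ha : 0 <= a) by apply norm_ge_0.
  destruct (Req_dec a 0) as [H0|H0].
  - exfalso; destruct (Hsurj y) as [u Hu].
    assert (Hz : inner y y = 0).
    { rewrite <- Hu at 1; rewrite adjoint_spec.
      apply Rabs_eq_0, Rle_antisym; [|apply Rabs_pos].
      apply Rle_trans with (1 := inner_Cauchy_Schwarz _ _).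
      change (norm (adjoint N y)) with a; rewrite H0; lra. }
    rewrite inner_norm in Hz; rewrite H0 in Hlt; nra.
  - exists (scal (/ a) y); rewrite lin_scal, !norm_scal_R.
    rewrite Rabs_pos_eq by (left; apply Rinv_0_lt_compat; lra).
    change (norm (adjoint N y)) with a.
    split; [|right; field; lra].
    apply Rmult_le_reg_r with a; [lra|].
    replace (/ a * norm y * a) with (norm y) by (field; lra); lra. }
destruct (functional_choice _ Hy) as [w Hw].
destruct (uniform_boundedness Y R_NormedModule (hilbert_banach Y)
    (fun n => mkLin (inner_is_linear Y (w n))))
  as [v Hv].
{ intros n; apply Rle_trans with (1 := proj1 (Hw n)).
  set (L := mkLin (inner_is_linear Y (w n))).
  assert (Hb := opnorm_bound L (w n)).
  change (Rabs (inner (w n) (w n)) <= opnorm L * norm (w n)) in Hb.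
  rewrite Rabs_pos_eq, inner_norm in Hb by apply inner_ge0.
  assert (Hp : 0 < norm (w n)).
  { apply Rlt_le_trans with (4 ^ n); [apply pow_lt; lra|apply (Hw n)]. }
  apply Rmult_le_reg_r with (norm (w n)); [exact Hp|]; lra. }
destruct (Hsurj v) as [u Hu].
destruct (Hv (fun r => norm u < r)) as [n Hn]; [now exists (norm u)|].
specialize (Hn n (Nat.le_refl n)); simpl in Hn.
change (norm u < Rabs (inner v (w n))) in Hn.
rewrite <- Hu, adjoint_spec in Hn.
generalize (inner_Cauchy_Schwarz u (adjoint N (w n))) (proj2 (Hw n)) (norm_ge_0 u); nra.
Qed.

(** * Strongly continuous semigroups *)

Lemma Riemann_sum_lin (E F : NormedSpace) (L : Lin E F) (phi : R -> E) (p : SF_seq) :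
  Riemann_sum (fun t => L (phi t)) p = L (Riemann_sum phi p).
Proof.
induction p as [x0|h p IH] using (@SF_cons_ind R).
- symmetry; exact (linear_zero L (lin_linear L)).
- rewrite !Riemann_sum_cons, IH, lin_plus, lin_scal; reflexivity.
Qed.

Lemma is_RInt_lin (E F : NormedSpace) (L : Lin E F) (phi : R -> E) (a b : R) (v : E) :
  is_RInt phi a b v -> is_RInt (fun t => L (phi t)) a b (L v).
Proof.
intros H.
assert (HL : continuous L v) by apply lin_continuous.
generalize (filterlim_comp _ _ _ _ _ _ _ _ H HL); apply filterlim_ext; intros p.
rewrite lin_scal; now rewrite Riemann_sum_lin.
Qed.

Lemma is_RInt_remainder (E : NormedSpace) (phi : R -> E) (a b c : R) (v w : E) :
  is_RInt phi a b v -> is_RInt phi a c w -> is_RInt phi b c (minus w v).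
Proof.
intros Hv Hw.
replace (minus w v) with (plus (opp v) w) by module_eq E.
apply is_RInt_Chasles with a; [now apply (is_RInt_swap phi)|exact Hw].
Qed.

Lemma is_RInt_near_const (E : NormedSpace) (phi : R -> E) (a b e : R) (v c : E) :
  a <= b -> is_RInt phi a b v -> (forall s, a <= s <= b -> norm (minus (phi s) c) <= e) ->
  norm (minus v (scal (b - a) c)) <= (b - a) * e.
Proof.
intros Hab Hv He.
apply norm_RInt_le_const with (f := fun s => minus (phi s) c); [exact Hab|exact He|].
exact (is_RInt_minus _ _ _ _ _ _ Hv (is_RInt_const a b c)).
Qed.

Section Semigroup.

Variables (E : NormedSpace) (cE : banach E) (T : R -> Lin E E) (D : E -> Prop) (G : E -> E).
Hypothesis hT : is_C0_semigroup T.
Hypothesis hG : is_generator T D G.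

Lemma semigroup_near_zero (w : E) e : 0 < e ->
  exists d, 0 < d /\ forall t, 0 <= t < d -> norm (minus (T t w) w) < e.
Proof.
intros He.
destruct (proj1 (at_right_0_iff _)
  (proj1 (filterlim_norm_iff E (at_right 0) (fun t => T t w) w) (@semigroup_cont E T hT w) e He))
  as [d [Hd H]].
exists d; split; [exact Hd|]; intros t Ht.
destruct (Req_dec t 0) as [->|H0].
- rewrite (semigroup_0 hT), norm_minus_self; exact He.
- apply H; lra.
Qed.

(** Otherwise there would be times [t n] tending to [0] with
    [opnorm (T (t n))] at least [4 ^ n]; but the orbits [T (t n) x] converge
    to [x], against uniform boundedness. *)
Lemma semigroup_locally_bounded :
  exists d K, 0 < d /\ 0 < K /\ forall t, 0 <= t <= d -> opnorm (T t) <= K.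
Proof.
apply NNPP; intros N.
assert (Ht : forall n : nat, exists t, 0 <= t <= / INR (S n) /\ 4 ^ n <= opnorm (T t)).
{ intros n; apply NNPP; intros Hn; apply N.
  exists (/ INR (S n)), (4 ^ n).
  split; [apply Rinv_0_lt_compat, lt_0_INR; lia|split; [apply pow_lt; lra|]].
  intros t Ht; apply Rnot_lt_le; intros Hlt; apply Hn; exists t; split; [exact Ht|lra]. }
destruct (functional_choice _ Ht) as [t Ht'].
destruct (uniform_boundedness E E cE (fun n => T (t n))) as [x Hx]; [apply Ht'|].
destruct (semigroup_near_zero x 1 Rlt_0_1) as [d [Hd H]].
destruct (Hx (fun r => norm x + 1 < r)) as [n Hn]; [now exists (norm x + 1)|].
destruct (archimed_cor1 d Hd) as [m [Hm Hm0]].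
set (k := Nat.max n m); specialize (Hn k ltac:(lia)); simpl in Hn.
destruct (Ht' k) as [Hk _].
assert (Hk' : / INR (S k) < d).
{ apply Rle_lt_trans with (/ INR m); [|exact Hm].
  apply Rinv_le_contravar; [now apply lt_0_INR|apply le_INR; lia]. }
specialize (H (t k) ltac:(lra)).
generalize (norm_le_minus _ (T (t k) x) x); lra.
Qed.

Lemma semigroup_orbit_continuous d K (w : E) :
  0 < K -> (forall t, 0 <= t <= d -> opnorm (T t) <= K) ->
  forall e, 0 < e -> exists r, 0 < r /\
    forall s t, 0 <= s <= d -> 0 <= t <= d -> Rabs (t - s) < r ->
      norm (minus (T t w) (T s w)) < e.
Proof.
intros HK Hb e He.
destruct (semigroup_near_zero w (e / K)) as [r [Hr H]]; [now apply Rdiv_lt_0_compat|].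
assert (main : forall s t, 0 <= s <= d -> 0 <= t <= d -> s <= t -> t - s < r ->
  norm (minus (T t w) (T s w)) < e).
{ intros s t Hs Ht Hst Hr'.
  replace t with (s + (t - s)) at 1 by ring.
  rewrite (semigroup_plus hT), <- lin_minus by lra.
  apply Rle_lt_trans with (1 := opnorm_bound (T s) _).
  apply Rle_lt_trans with (K * norm (minus (T (t - s) w) w)).
  - apply Rmult_le_compat_r; [apply norm_ge_0|now apply Hb].
  - specialize (H (t - s) ltac:(lra)).
    apply Rlt_le_trans with (K * (e / K)); [now apply Rmult_lt_compat_l|right; field; lra]. }
exists r; split; [exact Hr|]; intros s t Hs Ht Hst; apply Rabs_def2 in Hst.
destruct (Rle_lt_dec s t); [apply main; lra|].
rewrite norm_minus_sym; apply main; lra.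
Qed.

Lemma domain_invariant t y : 0 <= t -> D y -> D (T t y) /\ G (T t y) = T t (G y).
Proof.
intros Ht Dy; apply hG.
assert (H := proj1 (hG y (G y)) (conj Dy eq_refl)).
assert (HL : continuous (T t) (G y)) by apply lin_continuous.
generalize (filterlim_comp _ _ _ _ _ _ _ _ H HL); apply filterlim_ext_loc.
apply at_right_0_iff; exists 1; split; [lra|]; intros s Hs.
rewrite lin_scal, lin_minus, <- !(semigroup_plus hT) by lra.
now rewrite Rplus_comm.
Qed.

(** The time average of the orbit of [w] over a short interval is close to
    [w].  It lies in [D]: the flow shifts the interval of integration, so the
    difference quotient of the integral reduces to averages over two intervals
    of length [t] at its ends, which converge. *)
Lemma domain_dense (w : E) e : 0 < e -> exists y, D y /\ norm (minus y w) < e.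
Proof.
intros He.
destruct semigroup_locally_bounded as [d [K [Hd [HK Hb]]]].
destruct (semigroup_near_zero w (e / 2)) as [r [Hr Hw]]; [lra|].
set (tau := Rmin (d / 2) (r / 2)).
assert (Htau : 0 < tau) by (apply Rmin_pos; lra).
assert (Htd : tau <= d / 2) by apply Rmin_l.
assert (Htr : tau <= r / 2) by apply Rmin_r.
(* Reflected at zero, the orbit is continuous from both sides at time zero. *)
set (orb := fun s : R => T (Rabs s) w).
assert (Hint : forall a b, 0 <= a <= b -> b < d -> exists v, is_RInt orb a b v).
{ intros a b Ha Hbd.
  apply (@ex_RInt_continuous (complete_module E cE)).
  intros z Hz; rewrite Rmin_left, Rmax_right in Hz by lra.
  apply (continuous_norm_iff R_NormedModule E); intros r' Hr'.
  destruct (semigroup_orbit_continuous d K w HK Hb r' Hr') as [m [Hm H]].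
  exists (Rmin m (d - z)); split; [apply Rmin_pos; lra|].
  intros s Hs; change (Rabs (s - z) < Rmin m (d - z)) in Hs.
  assert (H1 := Rlt_le_trans _ _ _ Hs (Rmin_l _ _)).
  assert (H2 := Rlt_le_trans _ _ _ Hs (Rmin_r _ _)).
  unfold orb; rewrite (Rabs_pos_eq z) by lra.
  apply H; [lra| |].
  - split; [apply Rabs_pos|].
    replace s with ((s - z) + z) by ring.
    generalize (Rabs_triang (s - z) z); rewrite (Rabs_pos_eq z); lra.
  - apply Rle_lt_trans with (2 := H1).
    generalize (Rabs_triang_inv2 s z); rewrite (Rabs_pos_eq z); lra. }
destruct (Hint 0 tau ltac:(lra) ltac:(lra)) as [I HI].
set (y := scal (/ tau) I).
exists y; split.
- assert (HTI : filterlim (fun t => scal (/ t) (minus (T t I) I)) (at_right 0)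
                  (locally (minus (T tau w) w))).
  { apply (filterlim_norm_iff E (at_right 0)); intros r' Hr'.
    apply at_right_0_iff.
    destruct (semigroup_orbit_continuous d K w HK Hb (r' / 3)) as [m [Hm H]]; [lra|].
    exists (Rmin m (d / 2)); split; [apply Rmin_pos; lra|]; intros t Ht.
    assert (H1 := Rmin_l m (d / 2)); assert (H2 := Rmin_r m (d / 2)).
    destruct (Hint t (t + tau) ltac:(lra) ltac:(lra)) as [J HJ].
    destruct (Hint 0 t ltac:(lra) ltac:(lra)) as [I0 HI0].
    assert (HTJ : T t I = J).
    { apply (filterlim_locally_unique (F := Riemann_fine 0 tau) _ _ _
               (is_RInt_lin _ _ (T t) _ _ _ _ HI)).
      replace (t + tau) with (1 * tau + t) in HJ by ring.
      replace t with (1 * 0 + t) in HJ at 1 by ring.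
      apply is_RInt_comp_lin in HJ.
      apply is_RInt_ext with (2 := HJ); intros s Hs.
      rewrite Rmin_left, Rmax_right in Hs by lra.
      unfold orb; rewrite !Rabs_pos_eq by lra.
      rewrite <- (semigroup_plus hT) by lra.
      replace (1 * s + t) with (t + s) by ring; exact (scal_one _). }
    set (I1 := minus (plus I0 J) I : E).
    assert (HI1 : is_RInt orb tau (t + tau) I1).
    { apply is_RInt_remainder with 0; [exact HI|].
      now apply is_RInt_Chasles with t. }
    assert (E1 : norm (minus I1 (scal t (T tau w))) <= t * (r' / 3)).
    { assert (Hn := is_RInt_near_const _ orb tau (t + tau) (r' / 3) I1 (T tau w)).
      replace (t + tau - tau) with t in Hn by ring.
      apply Hn; [lra|exact HI1|]; intros s Hs.
      unfold orb; rewrite Rabs_pos_eq by lra; left; apply H; try lra.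
      rewrite Rabs_pos_eq; lra. }
    assert (E0 : norm (minus I0 (scal t w)) <= t * (r' / 3)).
    { assert (Hn := is_RInt_near_const _ orb 0 t (r' / 3) I0 w).
      rewrite Rminus_0_r in Hn.
      apply Hn; [lra|exact HI0|]; intros s Hs.
      unfold orb; rewrite Rabs_pos_eq by lra; left.
      rewrite <- (@semigroup_0 E T hT w) at 2; apply H; try lra.
      rewrite Rabs_pos_eq; lra. }
    rewrite HTJ.
    assert (Hid : minus (scal (/ t) (minus J I)) (minus (T tau w) w)
      = scal (/ t) (minus (minus I1 (scal t (T tau w))) (minus I0 (scal t w)) : E))
      by (unfold I1; module_eq E).
    apply Rle_lt_trans with (1 := Req_le _ _ (f_equal (fun z : E => norm z) Hid)).
    apply Rle_lt_trans with (/ t * (t * (r' / 3) + t * (r' / 3))).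
    - apply (norm_scal_le E); [left; apply Rinv_0_lt_compat; lra|].
      now apply (norm_minus_le E).
    - replace (/ t * (t * (r' / 3) + t * (r' / 3))) with (2 / 3 * r') by (field; lra); lra. }
  apply (hG y (scal (/ tau) (minus (T tau w) w))).
  generalize (filterlim_comp _ _ _ _ _ _ _ _ HTI
    (filterlim_scal_r (/ tau) (minus (T tau w) w))).
  apply filterlim_ext; intros t.
  unfold y; rewrite lin_scal; module_eq E.
- assert (Hy := is_RInt_near_const _ orb 0 tau (e / 2) I w ltac:(lra) HI).
  assert (Hid : minus y w = scal (/ tau) (minus I (scal (tau - 0) w) : E))
    by (unfold y; module_eq E).
  apply Rle_lt_trans with (1 := Req_le _ _ (f_equal (fun z : E => norm z) Hid)).
  apply Rle_lt_trans with (/ tau * ((tau - 0) * (e / 2))).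
  + apply (norm_scal_le E); [left; now apply Rinv_0_lt_compat|].
    apply Hy; intros s Hs; unfold orb; rewrite Rabs_pos_eq by lra.
    left; apply Hw; lra.
  + replace (/ tau * ((tau - 0) * (e / 2))) with (e / 2) by (field; lra); lra.
Qed.

End Semigroup.

(** * Functionals along mild solutions *)

Lemma strict_diff_increment (E : NormedSpace) (V : E -> R_NormedModule) (x v : E)
    (L : Lin E R_NormedModule) (c0 c1 : R -> E) :
  strict_diff V x L ->
  (forall e, 0 < e -> exists d, 0 < d /\ forall h, 0 < h < d -> norm (minus (c0 h) x) < e) ->
  (forall e, 0 < e -> exists d, 0 < d /\ forall h, 0 < h < d ->
     norm (minus (minus (c1 h) (c0 h)) (scal h v)) <= h * e) ->
  forall e, 0 < e -> exists d, 0 < d /\ forall h, 0 < h < d ->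
    V (c1 h) - V (c0 h) <= (L v + e) * h.
Proof.
intros HV H0 H1 e He.
assert (Hv := norm_ge_0 v); assert (HL := opnorm_ge0 L).
set (e1 := e / (2 * (norm v + 1))).
assert (He1 : 0 < e1) by (apply Rdiv_lt_0_compat; lra).
destruct (HV e1 He1) as [r [Hr HVr]].
set (e2 := Rmin 1 (e / (2 * (opnorm L + 1)))).
assert (He2 : 0 < e2) by (apply Rmin_pos; [lra|apply Rdiv_lt_0_compat; lra]).
destruct (H0 (r / 2) ltac:(lra)) as [d0 [Hd0 Hc0]].
destruct (H1 e2 He2) as [d1 [Hd1 Hc1]].
set (d2 := r / (2 * (norm v + 1))).
assert (Hd2 : 0 < d2) by (apply Rdiv_lt_0_compat; lra).
exists (Rmin d0 (Rmin d1 d2)); split; [now repeat apply Rmin_pos|]; intros h Hh.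
assert (Hh0 : h < d0) by (eapply Rlt_le_trans; [apply Hh|apply Rmin_l]).
assert (Hh' : h < Rmin d1 d2) by (eapply Rlt_le_trans; [apply Hh|apply Rmin_r]).
assert (Hh1 : h < d1) by (eapply Rlt_le_trans; [apply Hh'|apply Rmin_l]).
assert (Hh2 : h < d2) by (eapply Rlt_le_trans; [apply Hh'|apply Rmin_r]).
specialize (Hc0 h ltac:(lra)); specialize (Hc1 h ltac:(lra)).
set (p := minus (c1 h) (c0 h) : E) in *.
assert (He21 : e2 <= 1) by apply Rmin_l.
assert (He22 : opnorm L * e2 <= e / 2).
{ apply Rle_trans with ((opnorm L + 1) * (e / (2 * (opnorm L + 1)))).
  - apply Rmult_le_compat; [lra|lra|lra|apply Rmin_r].
  - right; field; lra. }
assert (Hp : norm p <= h * (norm v + 1)).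
{ apply Rle_trans with (1 := norm_le_minus _ p (scal h v)).
  rewrite norm_scal_R, Rabs_pos_eq by lra; nra. }
assert (Hpr : h * (norm v + 1) < r / 2).
{ apply Rlt_le_trans with (d2 * (norm v + 1)); [apply Rmult_lt_compat_r; lra|].
  right; unfold d2; field; lra. }
assert (Hc1r : norm (minus (c1 h) x) < r).
{ apply Rle_lt_trans with (1 := norm_minus_triangle _ _ (c0 h) _).
  change (norm p + norm (minus (c0 h) x) < r); lra. }
assert (Hd := HVr (c1 h) (c0 h) Hc1r ltac:(lra)).
change (Rabs (V (c1 h) - V (c0 h) - L p) <= e1 * norm p) in Hd.
assert (Hd' := Rle_trans _ _ _ (Rle_abs _) Hd).
assert (HLp : L p - h * L v <= opnorm L * (h * e2)).
{ assert (Hb := opnorm_bound L (minus p (scal h v))).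
  rewrite lin_minus, lin_scal in Hb.
  change (Rabs (L p - h * L v) <= opnorm L * norm (minus p (scal h v))) in Hb.
  apply Rle_trans with (1 := Rle_abs _), Rle_trans with (1 := Hb).
  now apply Rmult_le_compat_l. }
assert (e1 * norm p <= h * (e / 2)).
{ apply Rle_trans with (e1 * (h * (norm v + 1))); [apply Rmult_le_compat_l; lra|].
  right; unfold e1; field; lra. }
nra.
Qed.

Section Flow.

Variables (E : NormedSpace) (cE : banach E) (T : R -> Lin E E) (D : E -> Prop) (G : E -> E).
Hypothesis hT : is_C0_semigroup T.
Hypothesis hG : is_generator T D G.
Variables (V : E -> R_NormedModule) (dV : E -> Lin E R_NormedModule).
Hypothesis hV : forall x, strict_diff V x (dV x).

Lemma functional_continuous x : continuous V x.
Proof. exact (strict_diff_continuous _ _ V x (dV x) (lin_linear _) (hV x)). Qed.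

Lemma flow_growth_domain d K y k h :
  0 < K -> (forall t, 0 <= t <= d -> opnorm (T t) <= K) ->
  D y -> 0 <= h <= d -> (forall s, 0 <= s < h -> dV (T s y) (G (T s y)) <= k) ->
  V (T h y) - V y <= k * h.
Proof.
intros HK Hb Dy Hh Hk.
replace (V y) with (V (T 0 y)) by (now rewrite (@semigroup_0 E T hT y)).
replace (k * h) with (k * (h - 0)) by ring.
apply (dini_growth (fun s => V (T s y))); [lra| |].
- apply (continuous_on_postcomp E R_UniformSpace); [|exact functional_continuous].
  apply (continuous_on_R_norm_iff E); intros s Hs e He.
  destruct (semigroup_orbit_continuous E T hT d K y HK Hb e He) as [r [Hr H]].
  exists r; split; [exact Hr|]; intros t Ht Hts; apply H; lra.
- intros s Hs; apply dini_le_weaken with (1 := Hk s Hs).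
  destruct (domain_invariant E T D G hT hG s y ltac:(lra) Dy) as [Ds _].
  set (p := T s y) in *.
  intros e He.
  destruct (strict_diff_increment E V p (G p) (dV p) (fun _ => p) (fun r => T r p) (hV p))
    with (e := e) as [r [Hr H]].
  + intros e' He'; exists 1; split; [lra|]; intros r _; now rewrite norm_minus_self.
  + intros e' He'.
    assert (HG := proj1 (hG p (G p)) (conj Ds eq_refl)).
    destruct (proj1 (at_right_0_iff _) (proj1 (filterlim_norm_iff E (at_right 0) _ _) HG e' He'))
      as [r [Hr H]].
    exists r; split; [exact Hr|]; intros q Hq; specialize (H q Hq).
    assert (Hid : minus (minus (T q p) p) (scal q (G p))
      = scal q (minus (scal (/ q) (minus (T q p) p)) (G p)) :> E) by module_eq E.
    apply Rle_trans with (1 := Req_le _ _ (f_equal (fun z : E => norm z) Hid)).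
    apply (norm_scal_le E); [lra|left; exact H].
  + exact He.
  + exists r; split; [exact Hr|]; intros q Hq; specialize (H q Hq).
    replace (T (s + q) y) with (T q p); [exact H|].
    unfold p; rewrite Rplus_comm; symmetry; apply (semigroup_plus hT); lra.
Qed.

(** The bound on [dV y (G y)] is available on [D] only, but the resulting
    growth bound along the linear flow is stable under limits in [y], so it
    holds near [x] without any reference to [D]. *)
Lemma flow_growth x k r0 :
  0 < r0 -> (forall y, D y -> norm (minus y x) < r0 -> dV y (G y) <= k) ->
  exists rho, 0 < rho /\ forall y h, norm (minus y x) < rho -> 0 <= h < rho ->
    V (T h y) - V y <= k * h.
Proof.
intros Hr0 Hk.
destruct (semigroup_locally_bounded E cE T hT) as [d [K [Hd [HK Hb]]]].
destruct (semigroup_near_zero E T hT x (r0 / 2) ltac:(lra)) as [r1 [Hr1 Hx]].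
set (rho := Rmin d (Rmin r1 (r0 / (2 * K)))).
assert (Hrho : 0 < rho).
{ repeat apply Rmin_pos; try assumption; apply Rdiv_lt_0_compat; lra. }
assert (Hrd : rho <= d) by apply Rmin_l.
assert (Hr' : rho <= Rmin r1 (r0 / (2 * K))) by apply Rmin_r.
assert (Hrr : rho <= r1) by (apply Rle_trans with (1 := Hr'), Rmin_l).
assert (HrK : K * rho <= r0 / 2).
{ apply Rle_trans with (K * (r0 / (2 * K))); [|right; field; lra].
  apply Rmult_le_compat_l; [lra|]; apply Rle_trans with (1 := Hr'), Rmin_r. }
assert (HD : forall y h, D y -> norm (minus y x) < rho -> 0 <= h < rho ->
  V (T h y) - V y <= k * h).
{ intros y h Dy Hy Hh; apply flow_growth_domain with d K; try assumption; try lra.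
  intros s Hs; apply Hk.
  - now apply (domain_invariant E T D G hT hG).
  - apply Rle_lt_trans with (1 := norm_minus_triangle _ _ (T s x) _).
    rewrite <- lin_minus.
    assert (H1 := opnorm_bound (T s) (minus y x)).
    assert (H2 : opnorm (T s) * norm (minus y x) <= K * norm (minus y x))
      by (apply Rmult_le_compat_r; [apply norm_ge_0|apply Hb; lra]).
    assert (H3 : K * norm (minus y x) < K * rho) by now apply Rmult_lt_compat_l.
    assert (H4 := Hx s ltac:(lra)); lra. }
exists rho; split; [exact Hrho|]; intros y h Hy Hh.
apply Rle_of_le_eps; intros e He.
destruct (proj1 (continuous_norm_iff E R_NormedModule V y) (functional_continuous y) (e / 2))
  as [r2 [Hr2 H2]]; [lra|].
assert (HVT : continuous (fun z => V (T h z)) y).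
{ apply (continuous_comp (T h) V); [apply lin_continuous|apply functional_continuous]. }
destruct (proj1 (continuous_norm_iff E R_NormedModule _ y) HVT (e / 2))
  as [r3 [Hr3 H3]]; [lra|].
set (r4 := Rmin (rho - norm (minus y x)) (Rmin r2 r3)).
assert (Hr4 : 0 < r4) by (repeat apply Rmin_pos; lra).
destruct (domain_dense E cE T D G hT hG y r4 Hr4) as [z [Dz Hz]].
assert (Hz1 : norm (minus z y) < rho - norm (minus y x))
  by (apply Rlt_le_trans with (1 := Hz), Rmin_l).
assert (Hz' : norm (minus z y) < Rmin r2 r3) by (apply Rlt_le_trans with (1 := Hz), Rmin_r).
specialize (H2 z (Rlt_le_trans _ _ _ Hz' (Rmin_l _ _))).
specialize (H3 z (Rlt_le_trans _ _ _ Hz' (Rmin_r _ _))).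
change (Rabs (V z - V y) < e / 2) in H2.
change (Rabs (V (T h z) - V (T h y)) < e / 2) in H3.
apply Rabs_def2 in H2; apply Rabs_def2 in H3.
assert (Hzx := norm_minus_triangle _ z y x).
specialize (HD z h Dz ltac:(lra) Hh); lra.
Qed.

(** To first order, a curve issued from [x] that satisfies the mild equation
    is the linear flow followed by a displacement [h * phi]; the two effects on [V]
    add up. *)
Lemma dini_le_along_perturbed_flow (w : R -> E) (t : R) (phi : E) (k : E -> R_NormedModule) :
  (forall e, 0 < e -> exists d, 0 < d /\ forall h, 0 < h < d ->
     norm (minus (minus (w (t + h)) (T h (w t))) (scal h phi)) <= h * e) ->
  continuous k (w t) ->
  locally (w t) (fun y => D y -> dV y (G y) <= k y) ->
  dini_le (fun s => V (w s)) t (dV (w t) phi + k (w t)).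
Proof.
intros Hw Hk HG e He.
set (x := w t) in *.
destruct (proj1 (continuous_norm_iff E R_NormedModule k x) Hk (e / 2)) as [r1 [Hr1 H1]]; [lra|].
destruct (proj1 (locally_norm_iff E x _) HG) as [r2 [Hr2 H2]].
destruct (flow_growth x (k x + e / 2) (Rmin r1 r2)) as [rho [Hrho Hflow]].
- now apply Rmin_pos.
- intros y Dy Hy.
  specialize (H1 y (Rlt_le_trans _ _ _ Hy (Rmin_l _ _))).
  specialize (H2 y (Rlt_le_trans _ _ _ Hy (Rmin_r _ _)) Dy).
  change (Rabs (k y - k x) < e / 2) in H1; apply Rabs_def2 in H1; lra.
- destruct (strict_diff_increment E V x phi (dV x) (fun h => T h x) (fun h => w (t + h)) (hV x))
    with (e := e / 2) as [d [Hd H]]; [|exact Hw|lra|].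
  + intros e' He'; destruct (semigroup_near_zero E T hT x e' He') as [r [Hr H]].
    exists r; split; [exact Hr|]; intros h Hh; apply H; lra.
  + exists (Rmin d rho); split; [now apply Rmin_pos|]; intros h Hh.
    assert (Hh1 := Rmin_l d rho); assert (Hh2 := Rmin_r d rho).
    specialize (H h ltac:(lra)).
    specialize (Hflow x h ltac:(now rewrite norm_minus_self) ltac:(lra)).
    assert (Hsum : forall a b c p q : R, a - b <= (p + e / 2) * h ->
      b - c <= (q + e / 2) * h -> a - c <= (p + q + e) * h) by (intros; lra).
    exact (Hsum _ _ _ _ _ H Hflow).
Qed.

End Flow.

(** Splitting the variation-of-constants formula at time [t]: the part of the integral
    over [[0, t]] is carried along by [T h], and the rest is [h * phi t] up to [o(h)]. *)
Lemma mild_solution_increment (E : NormedSpace) (cE : banach E) (T : R -> Lin E E)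
    (w0 : E) (w phi : R -> E) :
  is_C0_semigroup T ->
  continuous_on (fun t => 0 <= t) phi ->
  (forall t, 0 <= t -> exists v, is_RInt (fun s => T (t - s) (phi s)) 0 t v /\
     w t = plus (T t w0) v) ->
  forall t, 0 <= t -> forall e, 0 < e -> exists d, 0 < d /\ forall h, 0 < h < d ->
    norm (minus (minus (w (t + h)) (T h (w t))) (scal h (phi t))) <= h * e.
Proof.
intros hT Hphi Hw t Ht e He.
destruct (semigroup_locally_bounded E cE T hT) as [d [K [Hd [HK Hb]]]].
destruct (semigroup_near_zero E T hT (phi t) (e / 2) ltac:(lra)) as [r1 [Hr1 H1]].
destruct (proj1 (continuous_on_R_norm_iff E _ phi) Hphi t Ht (e / (2 * K))) as [r2 [Hr2 H2]];
  [apply Rdiv_lt_0_compat; lra|].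
exists (Rmin d (Rmin r1 r2)); split; [now repeat apply Rmin_pos|]; intros h Hh.
assert (Hh0 : h < d) by (eapply Rlt_le_trans; [apply Hh|apply Rmin_l]).
assert (Hh' : h < Rmin r1 r2) by (eapply Rlt_le_trans; [apply Hh|apply Rmin_r]).
assert (Hh1 : h < r1) by (eapply Rlt_le_trans; [apply Hh'|apply Rmin_l]).
assert (Hh2 : h < r2) by (eapply Rlt_le_trans; [apply Hh'|apply Rmin_r]).
destruct (Hw t Ht) as [v [Hv Ew]].
destruct (Hw (t + h) ltac:(lra)) as [v' [Hv' Ew']].
assert (HTv : is_RInt (fun s => T (t + h - s) (phi s)) 0 t (T h v)).
{ apply is_RInt_ext with (2 := is_RInt_lin E E (T h) _ _ _ _ Hv); intros s Hs.
  rewrite Rmin_left, Rmax_right in Hs by lra.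
  rewrite <- (semigroup_plus hT) by lra.
  now replace (h + (t - s)) with (t + h - s) by ring. }
assert (Hrem := is_RInt_remainder E _ _ _ _ _ _ HTv Hv').
assert (Hn := is_RInt_near_const E _ t (t + h) e _ (phi t) ltac:(lra) Hrem).
replace (t + h - t) with h in Hn by ring.
replace (minus (w (t + h)) (T h (w t))) with (minus v' (T h v)).
- apply Hn; intros s Hs.
  replace (minus (T (t + h - s) (phi s)) (phi t))
    with (plus (T (t + h - s) (minus (phi s) (phi t)))
               (minus (T (t + h - s) (phi t)) (phi t)))
    by (rewrite lin_minus; module_eq E).
  eapply Rle_trans; [apply norm_triangle|].
  assert (Ha := opnorm_bound (T (t + h - s)) (minus (phi s) (phi t))).
  assert (Hc : opnorm (T (t + h - s)) * norm (minus (phi s) (phi t)) <= K * (e / (2 * K))).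
  { apply Rmult_le_compat; [apply opnorm_ge0|apply norm_ge_0|apply Hb; lra|].
    left; apply H2; [lra|rewrite Rabs_pos_eq; lra]. }
  replace (K * (e / (2 * K))) with (e / 2) in Hc by (field; lra).
  specialize (H1 (t + h - s) ltac:(lra)); lra.
- rewrite Ew, Ew', lin_plus, <- (semigroup_plus hT), (Rplus_comm h t) by lra.
  module_eq E.
Qed.

(** * Monotone functions at infinity *)

Lemma is_lim_infty_iff (F : R -> R) (l : R) :
  is_lim F p_infty l <-> forall e, 0 < e -> exists t0, forall t, t0 < t -> Rabs (F t - l) < e.
Proof.
split; intros H.
- apply is_lim_spec in H; intros e He; exact (H (mkposreal e He)).
- apply is_lim_spec; intros e; exact (H e (cond_pos e)).
Qed.

Lemma decreasing_nonneg_is_lim (F : R -> R) :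
  (forall t, 0 <= t -> 0 <= F t) -> (forall s t, 0 <= s <= t -> F t <= F s) ->
  exists l : R, is_lim F p_infty l.
Proof.
intros Hpos Hdec.
destruct (completeness (fun r => exists t, 0 <= t /\ r = - F t)) as [m [Hm1 Hm2]].
{ exists 0; intros r [t [Ht ->]]; generalize (Hpos t Ht); lra. }
{ exists (- F 0), 0; split; [lra|easy]. }
exists (- m); apply is_lim_infty_iff; intros e He.
assert (Hex : exists t, 0 <= t /\ F t < - m + e).
{ apply NNPP; intros N; assert (m <= m - e); [|lra].
  apply Hm2; intros r [t [Ht ->]].
  destruct (Rlt_le_dec (F t) (- m + e)); [exfalso; apply N; now exists t|lra]. }
destruct Hex as [t0 [Ht0 H0]].
exists t0; intros t Ht.
assert (- F t <= m) by (apply Hm1; exists t; split; [lra|easy]).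
generalize (Hdec t0 t ltac:(lra)); intros; apply Rabs_def1; lra.
Qed.

Lemma antitone_of_dini (F : R -> R) :
  continuous_on (fun t => 0 <= t) F -> (forall t, 0 <= t -> dini_le F t 0) ->
  forall s t, 0 <= s <= t -> F t <= F s.
Proof.
intros Hc Hd s t Hst.
assert (H : F t - F s <= 0 * (t - s)); [|lra].
apply dini_growth; [lra| |intros r Hr; apply Hd; lra].
apply (continuous_on_subset (T := R_UniformSpace) (U := R_UniformSpace)) with (2 := Hc).
intros r Hr; lra.
Qed.

(** If [r] stayed away from zero, [F] would decrease at least linearly and become negative. *)
Lemma dini_dissipation_lim (F r : R -> R) (a t0 l : R) :
  0 < a -> 0 <= t0 -> (forall t, 0 <= t -> 0 <= F t) ->
  continuous_on (fun t => 0 <= t) F ->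
  (forall t, t0 <= t -> dini_le F t (- (a * r t))) ->
  is_lim r p_infty l -> l <= 0.
Proof.
intros Ha Ht0 Hpos Hc Hd Hl.
destruct (Rle_lt_dec l 0) as [H|H]; [exact H|exfalso].
destruct (proj1 (is_lim_infty_iff r l) Hl (l / 2) ltac:(lra)) as [t1 H1].
set (s := Rmax t0 (t1 + 1)).
assert (Hs0 : t0 <= s) by apply Rmax_l.
assert (Hs1 : t1 + 1 <= s) by apply Rmax_r.
assert (Hal : 0 < a * (l / 2)) by (apply Rmult_lt_0_compat; lra).
set (b := s + (F s / (a * (l / 2)) + 1)).
assert (Hb0 : 0 <= F s / (a * (l / 2))).
{ apply Rmult_le_pos; [apply Hpos; lra|left; now apply Rinv_0_lt_compat]. }
assert (Hb : s <= b) by (unfold b; lra).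
assert (Hg : F b - F s <= - (a * (l / 2)) * (b - s)).
{ apply dini_growth; [exact Hb| |].
  - apply (continuous_on_subset (T := R_UniformSpace) (U := R_UniformSpace)) with (2 := Hc).
    intros t Ht; lra.
  - intros t Ht; apply dini_le_weaken with (2 := Hd t ltac:(lra)).
    specialize (H1 t ltac:(lra)); apply Rabs_def2 in H1.
    apply Ropp_le_contravar, Rmult_le_compat_l; lra. }
assert (Hbs : a * (l / 2) * (b - s) = F s + a * (l / 2)) by (unfold b; field; lra).
generalize (Hpos b ltac:(lra)); nra.
Qed.

(** * Bounded operators depending on a parameter *)

Lemma locally_lipschitz_continuous (E F : NormedSpace) (f : E -> F) (x : E) :
  locally_lipschitz f -> continuous f x.
Proof.
intros Hf; apply continuous_norm_iff; intros e He.
destruct (Hf (fun y => norm y <= norm x + 1)) as [K HK].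
{ now exists (norm x + 1). }
assert (HA := Rabs_pos K).
exists (Rmin 1 (e / (Rabs K + 1))); split.
{ apply Rmin_pos; [lra|apply Rdiv_lt_0_compat; lra]. }
intros y Hy.
assert (H1 := Rlt_le_trans _ _ _ Hy (Rmin_l _ _)).
assert (H2 := Rlt_le_trans _ _ _ Hy (Rmin_r _ _)).
assert (Hyx := norm_le_minus _ y x).
apply Rle_lt_trans with (1 := HK y x ltac:(lra) ltac:(lra)).
apply Rle_lt_trans with ((Rabs K + 1) * norm (minus y x)).
- apply Rmult_le_compat_r; [apply norm_ge_0|generalize (Rle_abs K); lra].
- apply Rlt_le_trans with ((Rabs K + 1) * (e / (Rabs K + 1)));
    [apply Rmult_lt_compat_l; lra|right; field; lra].
Qed.

(** The hypothesis is what a bounded bilinear map satisfies; evaluation,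
    composition and the inner product are all of this kind. *)
Lemma continuous_bilinear (Z E F H : NormedSpace) (B : E -> F -> H)
    (p : Z -> E) (q : Z -> F) (x : Z) :
  (forall a a' b b', norm (minus (B a b) (B a' b')) <=
     norm (minus a a') * norm b + norm a' * norm (minus b b')) ->
  continuous p x -> continuous q x -> continuous (fun y => B (p y) (q y)) x.
Proof.
intros HB Hp Hq; apply continuous_norm_iff; intros e He.
set (P := norm (p x)); set (Q := norm (q x)).
assert (HP : 0 <= P) by apply norm_ge_0.
assert (HQ : 0 <= Q) by apply norm_ge_0.
set (e1 := e / (2 * (Q + 1))); set (e2 := Rmin 1 (e / (2 * (P + 1)))).
assert (He1 : 0 < e1) by (apply Rdiv_lt_0_compat; lra).
assert (He2 : 0 < e2) by (apply Rmin_pos; [lra|apply Rdiv_lt_0_compat; lra]).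
destruct (proj1 (continuous_norm_iff _ _ p x) Hp e1 He1) as [d1 [Hd1 H1]].
destruct (proj1 (continuous_norm_iff _ _ q x) Hq e2 He2) as [d2 [Hd2 H2]].
exists (Rmin d1 d2); split; [now apply Rmin_pos|]; intros y Hy.
specialize (H1 y (Rlt_le_trans _ _ _ Hy (Rmin_l _ _))).
specialize (H2 y (Rlt_le_trans _ _ _ Hy (Rmin_r _ _))).
apply Rle_lt_trans with (1 := HB _ _ _ _).
assert (H3 : norm (q y) <= Q + 1).
{ generalize (norm_le_minus _ (q y) (q x)) (Rmin_l 1 (e / (2 * (P + 1)))).
  fold Q e2; lra. }
assert (H4 : norm (minus (p y) (p x)) * norm (q y) < e / 2).
{ apply Rle_lt_trans with (norm (minus (p y) (p x)) * (Q + 1)).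
  - apply Rmult_le_compat_l; [apply norm_ge_0|exact H3].
  - apply Rlt_le_trans with (e1 * (Q + 1)); [apply Rmult_lt_compat_r; lra|].
    right; unfold e1; field; lra. }
assert (H5 : P * norm (minus (q y) (q x)) <= e / 2).
{ apply Rle_trans with ((P + 1) * (e / (2 * (P + 1)))); [|right; field; lra].
  apply Rmult_le_compat; [lra|apply norm_ge_0|lra|].
  left; apply Rlt_le_trans with (1 := H2), Rmin_r. }
fold P; lra.
Qed.

Lemma continuous_eval (Z E F : NormedSpace) (L : Z -> Lin E F) (v : Z -> E) (x : Z) :
  continuous L x -> continuous v x -> continuous (fun y => L y (v y)) x.
Proof.
apply (continuous_bilinear Z (Lin_NormedModule E F) E F (fun (l : Lin E F) a => l a)).
intros a a' b b'.
replace (minus (a b) (a' b')) with (plus (minus (a b) (a' b)) (a' (minus b b')))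
  by (rewrite lin_minus; module_eq F).
eapply Rle_trans; [apply norm_triangle|].
apply Rplus_le_compat; [apply lin_bound_minus|apply (opnorm_bound a')].
Qed.

Lemma continuous_inner (Z : NormedSpace) (H : RealHilbert) (v w : Z -> H) (x : Z) :
  continuous v x -> continuous w x ->
  continuous (U := R_NormedModule) (fun y => inner (v y) (w y)) x.
Proof.
apply (continuous_bilinear Z H H R_NormedModule (fun a b : H => inner a b)).
intros a a' b b'.
change (Rabs (inner a b - inner a' b') <=
  norm (minus a a') * norm b + norm a' * norm (minus b b')).
replace (inner a b - inner a' b')
  with (inner (minus a a') b + inner a' (minus b b')).
2: { unfold minus; rewrite inner_plus_l, inner_plus_r, inner_opp_l, inner_opp_r; ring. }
eapply Rle_trans; [apply Rabs_triang|].
apply Rplus_le_compat; apply inner_Cauchy_Schwarz.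
Qed.

Definition Lin_comp {E F H : NormedSpace} (L : Lin E F) (L' : Lin F H) : Lin E H :=
  mkLin (is_linear_comp L L' (lin_linear L) (lin_linear L')).

Lemma continuous_Lin_comp (Z E F H : NormedSpace) (L : Z -> Lin E F) (L' : Z -> Lin F H)
    (x : Z) :
  continuous L x -> continuous L' x -> continuous (fun y => Lin_comp (L y) (L' y)) x.
Proof.
intros HL HL'.
apply (continuous_bilinear Z (Lin_NormedModule F H) (Lin_NormedModule E F)
  (Lin_NormedModule E H) (fun l' l => Lin_comp l l')); [|assumption|assumption].
intros a a' b b'.
apply opnorm_le.
- assert (P1 := norm_ge_0 (minus a a')); assert (P2 := norm_ge_0 b).
  assert (P3 := norm_ge_0 a'); assert (P4 := norm_ge_0 (minus b b')).
  apply Rplus_le_le_0_compat; now apply Rmult_le_pos.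
- intros v; change (norm (minus (a (b v)) (a' (b' v))) <=
    (norm (minus a a') * norm b + norm a' * norm (minus b b')) * norm v).
  replace (minus (a (b v)) (a' (b' v)))
    with (plus (minus (a (b v)) (a' (b v))) (a' (minus (b v) (b' v))))
    by (rewrite lin_minus; module_eq H).
  eapply Rle_trans; [apply norm_triangle|].
  rewrite Rmult_plus_distr_r, !Rmult_assoc.
  apply Rplus_le_compat.
  + eapply Rle_trans; [apply lin_bound_minus|].
    apply Rmult_le_compat_l; [apply norm_ge_0|apply (opnorm_bound b)].
  + eapply Rle_trans; [apply (opnorm_bound a')|].
    apply Rmult_le_compat_l; [apply opnorm_ge0|apply lin_bound_minus].
Qed.

Lemma adjoint_comp (E F H : RealHilbert) (L : Lin E F) (L' : Lin F H) (y : H) :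
  adjoint (Lin_comp L L') y = adjoint L (adjoint L' y).
Proof.
apply inner_eq; intros z; rewrite <- !adjoint_spec; reflexivity.
Qed.

Lemma adjoint_minus_norm (E F : RealHilbert) (L L' : Lin E F) :
  norm (minus (adjoint L) (adjoint L')) <= norm (minus L L').
Proof.
apply opnorm_le; [apply norm_ge_0|]; intros y.
change (norm (minus (adjoint L y) (adjoint L' y)) <= norm (minus L L') * norm y).
set (v := minus (adjoint L y) (adjoint L' y) : E).
assert (Hv : norm v ^ 2 <= norm v * (norm (minus L L') * norm y)).
{ rewrite <- inner_norm.
  replace (inner v v) with (inner (minus (L v) (L' v)) y).
  - eapply Rle_trans; [apply Rle_abs|].
    eapply Rle_trans; [apply inner_Cauchy_Schwarz|].
    assert (Hb := lin_bound_minus _ _ L L' v).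
    apply (Rmult_le_compat_r (norm y)) in Hb; [|apply norm_ge_0].
    apply Rle_trans with (1 := Hb); right; ring.
  - unfold v at 4; unfold minus.
    rewrite inner_plus_l, inner_plus_r, inner_opp_l, inner_opp_r, !adjoint_spec; reflexivity. }
destruct (Req_dec (norm v) 0) as [->|Hn].
- apply Rmult_le_pos; apply norm_ge_0.
- apply Rmult_le_reg_l with (norm v); [generalize (norm_ge_0 v); lra|].
  simpl in Hv; lra.
Qed.

Lemma continuous_adjoint (Z : NormedSpace) (E F : RealHilbert) (L : Z -> Lin E F) (x : Z) :
  continuous L x -> continuous (fun y => adjoint (L y)) x.
Proof.
intros HL; apply continuous_norm_iff; intros e He.
destruct (proj1 (continuous_norm_iff _ _ L x) HL e He) as [d [Hd H]].
exists d; split; [exact Hd|]; intros y Hy.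
apply Rle_lt_trans with (1 := adjoint_minus_norm _ _ (L y) (L x)); now apply H.
Qed.

(** * Calculus on products and Hilbert spaces *)

Section Product.

Variables X Y : NormedSpace.
Notation XY := (prod_NormedModule R_AbsRing X Y).

Lemma norm_prod (w : XY) : norm w = sqrt (norm (fst w) ^ 2 + norm (snd w) ^ 2).
Proof. reflexivity. Qed.

Lemma norm_fst_le (w : XY) : norm (fst w) <= norm w.
Proof.
rewrite norm_prod, <- (sqrt_pow2 (norm (fst w))) at 1 by apply norm_ge_0.
apply sqrt_le_1_alt; generalize (pow2_ge_0 (norm (snd w))); lra.
Qed.

Lemma norm_prod_le (w : XY) : norm w <= norm (fst w) + norm (snd w).
Proof.
generalize (norm_ge_0 (fst w)) (norm_ge_0 (snd w)); intros H1 H2.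
rewrite norm_prod, <- (sqrt_pow2 (norm (fst w) + norm (snd w))) by lra.
apply sqrt_le_1_alt; nra.
Qed.

Lemma continuous_pair (Z : UniformSpace) (p : Z -> X) (q : Z -> Y) (x : Z) :
  continuous p x -> continuous q x -> continuous (U := XY) (fun y => (p y, q y)) x.
Proof.
intros Hp Hq; apply filterlim_locally; intros e.
generalize (filter_and _ _ (proj1 (filterlim_locally _ _) Hp e)
                           (proj1 (filterlim_locally _ _) Hq e)).
apply filter_imp; intros y Hy; exact Hy.
Qed.

Lemma continuous_fst_prod (w : XY) : continuous (fun w : XY => fst w) w.
Proof. apply (linear_cont (U := XY)), is_linear_fst. Qed.

Lemma continuous_snd_prod (w : XY) : continuous (fun w : XY => snd w) w.
Proof. apply (linear_cont (U := XY)), is_linear_snd. Qed.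

Definition Lin_fst : Lin XY X := @mkLin XY X _ is_linear_fst.
Definition Lin_snd : Lin XY Y := @mkLin XY Y _ is_linear_snd.

Lemma strict_diff_fst (F : NormedSpace) (f : X -> F) (w : XY) (L : Lin X F) :
  strict_diff f (fst w) L -> strict_diff (fun w : XY => f (fst w)) w (Lin_comp Lin_fst L).
Proof.
intros H e He; destruct (H e He) as [d [Hd H']]; exists d; split; [exact Hd|].
intros a b Ha Hb.
eapply Rle_trans.
- apply H'.
  + apply Rle_lt_trans with (2 := Ha); exact (norm_fst_le (minus a w)).
  + apply Rle_lt_trans with (2 := Hb); exact (norm_fst_le (minus b w)).
- apply Rmult_le_compat_l; [lra|]; exact (norm_fst_le (minus a b)).
Qed.

End Product.

Lemma strict_diff_half_norm2 (E : NormedSpace) (H : RealHilbert) (f : E -> H) (x : E)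
    (L : Lin E H) :
  strict_diff f x L ->
  strict_diff (F := R_NormedModule) (fun y => / 2 * norm (f y) ^ 2) x
    (Lin_comp L (mkLin (inner_is_linear H (f x)))).
Proof.
intros Hf e He.
set (K := opnorm L + 1); assert (HL := opnorm_ge0 L).
set (N := norm (f x)); assert (HN : 0 <= N) by apply norm_ge_0.
set (e1 := Rmin 1 (e / (2 * (N + 1)))).
assert (He1 : 0 < e1) by (apply Rmin_pos; [lra|apply Rdiv_lt_0_compat; lra]).
assert (He11 : e1 <= 1) by apply Rmin_l.
assert (He12 : N * e1 <= e / 2).
{ apply Rle_trans with ((N + 1) * (e / (2 * (N + 1)))); [|right; field; lra].
  apply Rmult_le_compat; [lra|lra|lra|apply Rmin_r]. }
destruct (Hf e1 He1) as [d1 [Hd1 H1]].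
assert (Hc := strict_diff_continuous _ _ f x L (lin_linear L) Hf).
destruct (proj1 (continuous_norm_iff _ _ f x) Hc (e / (2 * K))) as [d2 [Hd2 H2]];
  [unfold K; apply Rdiv_lt_0_compat; lra|].
exists (Rmin d1 d2); split; [now apply Rmin_pos|]; intros a b Ha Hb.
specialize (H1 a b (Rlt_le_trans _ _ _ Ha (Rmin_l _ _)) (Rlt_le_trans _ _ _ Hb (Rmin_l _ _))).
assert (H2a := H2 a (Rlt_le_trans _ _ _ Ha (Rmin_r _ _))).
assert (H2b := H2 b (Rlt_le_trans _ _ _ Hb (Rmin_r _ _))).
set (p := minus (f a) (f b) : H) in *; set (l := L (minus a b)) in *.
set (m := scal (/ 2) (plus (minus (f a) (f x)) (minus (f b) (f x))) : H).
change (Rabs (/ 2 * norm (f a) ^ 2 - / 2 * norm (f b) ^ 2 - inner l (f x))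
  <= e * norm (minus a b)).
assert (Hid : / 2 * norm (f a) ^ 2 - / 2 * norm (f b) ^ 2 - inner l (f x)
  = inner m p + inner (minus p l) (f x)).
{ rewrite <- !inner_norm; unfold m, p, minus.
  rewrite !inner_scal_l, !inner_plus_l, !inner_plus_r, !inner_opp_l, !inner_opp_r,
    (inner_sym (f b) (f a)), (inner_sym (f x) (f a)), (inner_sym (f x) (f b)); field. }
rewrite Hid.
assert (Hv := norm_ge_0 (minus a b)).
assert (Hp : norm p <= K * norm (minus a b)).
{ apply Rle_trans with (1 := norm_le_minus _ p l).
  assert (Hl := opnorm_bound L (minus a b)); fold l in Hl.
  assert (Hn : e1 * norm (minus a b) <= 1 * norm (minus a b)) by (apply Rmult_le_compat_r; lra).
  apply Rle_trans with (1 := Rplus_le_compat _ _ _ _ H1 Hl); unfold K; lra. }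
assert (Hm : norm m <= e / (2 * K)).
{ replace (e / (2 * K)) with (/ 2 * (e / (2 * K) + e / (2 * K)))
    by (generalize (e / (2 * K)); intros; field).
  apply (norm_scal_le H); [lra|].
  exact (Rle_trans _ _ _ (norm_triangle _ _)
    (Rplus_le_compat _ _ _ _ (Rlt_le _ _ H2a) (Rlt_le _ _ H2b))). }
eapply Rle_trans; [apply Rabs_triang|].
assert (C1 := inner_Cauchy_Schwarz m p).
assert (C2 := inner_Cauchy_Schwarz (minus p l) (f x)); fold N in C2.
assert (C3 : norm m * norm p <= e / (2 * K) * (K * norm (minus a b)))
  by (apply Rmult_le_compat; try apply norm_ge_0; assumption).
replace (e / (2 * K) * (K * norm (minus a b))) with (e / 2 * norm (minus a b)) in C3
  by (unfold K; field; lra).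
assert (C4 : norm (minus p l) * N <= e1 * norm (minus a b) * N)
  by (apply Rmult_le_compat_r; assumption).
nra.
Qed.

Lemma inner_minus_l (H : RealHilbert) (x y z : H) :
  inner (minus x y) z = inner x z - inner y z.
Proof. unfold minus; rewrite inner_plus_l, inner_opp_l; ring. Qed.

Lemma skew_adjoint_inner (Y : RealHilbert) (S : Lin Y Y) (y : Y) :
  skew_adjoint S -> inner (S y) y = 0.
Proof.
intros HS.
assert (H := adjoint_spec S y y); rewrite HS in H.
change (inner (S y) y = inner y (opp (S y))) in H.
rewrite inner_opp_r, (inner_sym y) in H; lra.
Qed.

(** * The closed loop *)

Section ClosedLoopAnalysis.

Variables (X U Y : RealHilbert) (D : X -> Prop) (A f : X -> X) (g : X -> Lin U X).
Variables (S : Lin Y Y) (C h : X -> Y) (M : X -> Y) (dM : X -> Lin X Y).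
Hypothesis hf : locally_lipschitz f.
Hypothesis hg : locally_lipschitz g.
Hypothesis hh : locally_lipschitz h.
Hypothesis hS : skew_adjoint S.
Hypothesis hIG : invariant_graph D A f S C h M dM.

Notation State := (state_space X Y).

Let hM : is_C1 M dM.
Proof. exact (proj1 hIG). Qed.

Let M_cont x : continuous M x.
Proof. exact (C1_continuous _ _ M dM x hM). Qed.

Let dM_cont x : continuous dM x.
Proof. exact (proj2 hM x). Qed.

Let f_cont x : continuous f x.
Proof. exact (locally_lipschitz_continuous _ _ f x hf). Qed.

Let g_cont x : continuous g x.
Proof. exact (locally_lipschitz_continuous _ _ g x hg). Qed.

Let h_cont x : continuous h x.
Proof. exact (locally_lipschitz_continuous _ _ h x hh). Qed.

Definition input_map (x : X) : Lin U Y := Lin_comp (g x) (dM x).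

Definition deviation (w : State) : Y := minus (snd w) (M (fst w)).

Definition control (w : State) : U := feedback g M dM (fst w) (snd w).

Lemma control_eq w : control w = adjoint (input_map (fst w)) (deviation w).
Proof. symmetry; apply adjoint_comp. Qed.

Lemma input_map_continuous x : continuous input_map x.
Proof. now apply continuous_Lin_comp. Qed.

Lemma continuous_of_fst (F : UniformSpace) (p : X -> F) (w : State) :
  continuous p (fst w) -> continuous (fun w : State => p (fst w)) w.
Proof.
intros Hp; apply (continuous_comp (fun w : State => fst w) p); [|exact Hp].
apply continuous_fst_prod.
Qed.

Lemma deviation_continuous w : continuous deviation w.
Proof.
apply (@continuous_minus State R_AbsRing Y (fun w => snd w) (fun w => M (fst w))).
- apply continuous_snd_prod.
- now apply continuous_of_fst.
Qed.

Lemma control_continuous w : continuous control w.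
Proof.
apply continuous_ext with (f := fun w => adjoint (input_map (fst w)) (deviation w)).
{ intros z; symmetry; apply control_eq. }
apply (continuous_eval State Y U (fun w => adjoint (input_map (fst w))) deviation).
- apply (continuous_adjoint State U Y (fun w : State => input_map (fst w))).
  apply continuous_of_fst, input_map_continuous.
- apply deviation_continuous.
Qed.

Definition vector_field : State -> State := closed_loop_nonlinear f g S h M dM.

Lemma vector_field_eq w :
  vector_field w = (plus (f (fst w)) (g (fst w) (control w)), plus (S (snd w)) (h (fst w))).
Proof. now destruct w. Qed.

Lemma vector_field_continuous w : continuous vector_field w.
Proof.
apply continuous_ext with (f := fun w : State =>
  (plus (f (fst w)) (g (fst w) (control w)), plus (S (snd w)) (h (fst w)))).
{ intros z; symmetry; apply vector_field_eq. }
apply (continuous_pair X Y State).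
- apply (@continuous_plus State R_AbsRing X); [now apply continuous_of_fst|].
  apply (continuous_eval State U X (fun w => g (fst w)) control).
  + now apply continuous_of_fst.
  + apply control_continuous.
- apply (@continuous_plus State R_AbsRing Y); [|now apply continuous_of_fst].
  apply (continuous_comp (fun w : State => snd w) S); [apply continuous_snd_prod|].
  exact (lin_continuous Y Y S _).
Qed.

Definition half_deviation2 (w : State) : R_NormedModule := / 2 * norm (deviation w) ^ 2.

Definition deviation_diff (w : State) : Lin State Y :=
  minus (Lin_snd X Y) (Lin_comp (Lin_fst X Y) (dM (fst w))).

Lemma deviation_strict_diff w : strict_diff deviation w (deviation_diff w).
Proof.
intros e He.
destruct (strict_diff_fst X Y Y M w (dM (fst w)) (C1_strict_diff _ _ M dM (fst w) hM) e He)
  as [d [Hd H]].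
exists d; split; [exact Hd|]; intros a b Ha Hb; specialize (H a b Ha Hb).
apply Rle_trans with (2 := H), Req_le.
rewrite <- norm_opp; f_equal.
change (opp (minus (minus (minus (snd a) (M (fst a))) (minus (snd b) (M (fst b))))
    (minus (minus (snd a) (snd b)) (dM (fst w) (minus (fst a) (fst b)))))
  = minus (minus (M (fst a)) (M (fst b))) (dM (fst w) (minus (fst a) (fst b)))).
module_eq Y.
Qed.

Section Trajectory.

Variables (w0 : State) (w : R -> State).
Hypothesis hw : closed_loop_solution D A f g S C h M dM w0 w.

Lemma trajectory_continuous : continuous_on (fun t => 0 <= t) w.
Proof. exact (proj1 hw). Qed.

Lemma trajectory_initial : w 0 = w0.
Proof.
destruct hw as [_ [T [hT [_ Hmild]]]].
destruct (Hmild 0 (Rle_refl 0)) as [v [Hv ->]].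
rewrite (@semigroup_0 State T hT w0).
rewrite (filterlim_locally_unique (F := Riemann_fine 0 0) _ _ _ Hv (is_RInt_point _ _)).
apply plus_zero_r.
Qed.

Lemma trajectory_dini (V : State -> R_NormedModule) (dV : State -> Lin State R_NormedModule)
    (k : State -> R_NormedModule) (t : R) :
  (forall x, strict_diff V x (dV x)) -> 0 <= t ->
  continuous k (w t) ->
  locally (w t) (fun y => D (fst y) -> dV y (closed_loop_linear A C y) <= k y) ->
  dini_le (fun s => V (w s)) t (dV (w t) (vector_field (w t)) + k (w t)).
Proof.
intros HV Ht Hk HD.
destruct hw as [Hc [T [hT [hG Hmild]]]].
assert (cXY : banach State) by exact (prod_banach X Y (hilbert_banach X) (hilbert_banach Y)).
apply (dini_le_along_perturbed_flow State cXY T _ _ hT hG V dV HV w t _ k); [|exact Hk|exact HD].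
apply (mild_solution_increment State cXY T w0 w (fun s => vector_field (w s)) hT); [|exact Hmild|exact Ht].
apply (continuous_on_postcomp State State); [exact Hc|apply vector_field_continuous].
Qed.

(** On the domain, the derivative of the deviation along the linear part is
    [C x - dM x (A x)]; the invariance of the graph equates it with
    [dM x (f x) - S (M x) - h x], in which no unbounded operator is left, so
    it is continuous in the state.  Adding the contribution of the nonlinear
    part leaves [S e - dM x (g x u)] with [e] the deviation.  The first term
    is orthogonal to [e], and the feedback is chosen so that the second one
    contributes [- norm u ^ 2]. *)
Lemma trajectory_dini_deviation t : 0 <= t ->
  dini_le (fun s => half_deviation2 (w s)) t (- norm (control (w t)) ^ 2).
Proof.
intros Ht.
set (dq := fun w : State => Lin_comp (deviation_diff w) (mkLin (inner_is_linear Y (deviation w)))).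
set (drift := fun y : State =>
  minus (dM (fst y) (f (fst y))) (plus (S (M (fst y))) (h (fst y))) : Y).
set (k := fun y : State => inner (drift y) (deviation y) : R_NormedModule).
apply dini_le_weaken with (dq (w t) (vector_field (w t)) + k (w t)).
- right.
  change (inner (deviation_diff (w t) (vector_field (w t))) (deviation (w t)) +
    inner (drift (w t)) (deviation (w t)) = - norm (control (w t)) ^ 2).
  rewrite <- inner_norm, control_eq, <- adjoint_spec, <- control_eq.
  rewrite <- inner_plus_l.
  rewrite vector_field_eq; set (y := w t).
  assert (Hid : plus (deviation_diff y (plus (f (fst y)) (g (fst y) (control y)),
      plus (S (snd y)) (h (fst y)))) (drift y)
    = minus (S (deviation y)) (input_map (fst y) (control y)) :> Y).
  { change (plus (minus (plus (S (snd y)) (h (fst y)))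
                        (dM (fst y) (plus (f (fst y)) (g (fst y) (control y))))) (drift y) =
      minus (S (minus (snd y) (M (fst y)))) (dM (fst y) (g (fst y) (control y)))).
    unfold drift; rewrite lin_minus, lin_plus; module_eq Y. }
  apply eq_trans with (1 := f_equal (fun z : Y => inner z (deviation y)) Hid).
  rewrite inner_minus_l, (skew_adjoint_inner Y S) by exact hS; ring.
- apply (trajectory_dini half_deviation2 dq k t); [|exact Ht| |].
  + intros x; apply strict_diff_half_norm2, deviation_strict_diff.
  + apply (continuous_inner State Y drift deviation); [|apply deviation_continuous].
    apply (continuous_of_fst Y (fun x => minus (dM x (f x)) (plus (S (M x)) (h x)))).
    apply (@continuous_minus X R_AbsRing Y).
    * now apply (continuous_eval X X Y dM f).
    * apply (@continuous_plus X R_AbsRing Y); [|apply h_cont].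
      apply (continuous_comp M S); [apply M_cont|exact (lin_continuous Y Y S _)].
  + apply (filter_forall (F := locally (w t))); intros y Dy; right.
    change (inner (minus (C (fst y)) (dM (fst y) (A (fst y)))) (deviation y) = k y).
    unfold k; f_equal; unfold drift.
    destruct hIG as [_ [_ [_ HG]]]; specialize (HG (fst y) Dy).
    rewrite lin_plus in HG.
    replace (dM (fst y) (A (fst y))) with
      (minus (plus (dM (fst y) (A (fst y))) (dM (fst y) (f (fst y)))) (dM (fst y) (f (fst y))))
      by module_eq Y.
    rewrite HG; module_eq Y.
Qed.

(** With the input frozen at its present value [u], the dissipation
    inequality bounds [dV y (A y)] by [k u y - dV y (f y + g y u)], which is
    continuous in [y]; at [y = x(t)] the subtracted term is exactly what the
    nonlinear part contributes. *)
Lemma trajectory_dini_state (V : X -> R_NormedModule) (dV : X -> Lin X R_NormedModule)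
    (B : X -> Prop) (k : U -> X -> R_NormedModule) t :
  is_C1 V dV -> 0 <= t -> open B -> B (fst (w t)) ->
  (forall u x, continuous (k u) x) ->
  (forall x u, D x -> B x -> dV x (plus (plus (A x) (f x)) (g x u)) <= k u x) ->
  dini_le (fun s => V (fst (w s))) t (k (control (w t)) (fst (w t))).
Proof.
intros HV Ht HB Bt Hk Hdiss.
set (u := control (w t)).
set (dVf := fun w : State => Lin_comp (Lin_fst X Y) (dV (fst w))).
set (l := fun x : X => minus (k u x) (dV x (plus (f x) (g x u))) : R_NormedModule).
replace (k u (fst (w t)))
  with (dVf (w t) (vector_field (w t)) + l (fst (w t))).
- apply (trajectory_dini (fun y : State => V (fst y)) dVf (fun y : State => l (fst y)) t); [|exact Ht| |].
  + intros x; apply strict_diff_fst; now apply C1_strict_diff.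
  + apply (continuous_of_fst R_NormedModule l).
    apply (@continuous_minus X R_AbsRing R_NormedModule); [apply Hk|].
    apply (continuous_eval X X R_NormedModule dV (fun x => plus (f x) (g x u))).
    * apply (proj2 HV).
    * apply (@continuous_plus X R_AbsRing X); [apply f_cont|].
      apply (continuous_eval X U X g (fun _ => u)); [apply g_cont|apply continuous_const].
  + generalize (continuous_fst_prod X Y (w t) B (HB _ Bt)).
    apply (filter_imp (F := locally (w t))); intros y By Dy.
    specialize (Hdiss (fst y) u Dy By).
    rewrite <- plus_assoc, lin_plus in Hdiss.
    change (dV (fst y) (A (fst y)) + dV (fst y) (plus (f (fst y)) (g (fst y) u))
      <= k u (fst y)) in Hdiss.
    change (dV (fst y) (A (fst y)) <=
      k u (fst y) - dV (fst y) (plus (f (fst y)) (g (fst y) u))).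
    exact (Rle_trans _ _ _ (Req_le _ _ (eq_sym (Rplus_minus_r _ _)))
      (Rplus_le_compat_r (- dV (fst y) (plus (f (fst y)) (g (fst y) u))) _ _ Hdiss)).
- rewrite vector_field_eq; fold u.
  change (dV (fst (w t)) (plus (f (fst (w t))) (g (fst (w t)) u)) +
    (k u (fst (w t)) - dV (fst (w t)) (plus (f (fst (w t))) (g (fst (w t)) u)))
    = k u (fst (w t))).
  apply Rplus_minus.
Qed.

End Trajectory.

End ClosedLoopAnalysis.

Lemma lt_of_scaled_squares (m a r : R) : 0 < m -> 0 < r -> m * a ^ 2 < m * r ^ 2 -> a < r.
Proof.
intros Hm Hr H; apply Rmult_lt_reg_l in H; [|exact Hm].
destruct (Rlt_le_dec a r); [assumption|nra].
Qed.

Lemma lt_scaled_square (a m : R) : 0 < m -> 0 <= a -> a < m * (a / m + 1) ^ 2.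
Proof.
intros Hm Ha; assert (Hs : 0 <= a / m)
  by (apply Rmult_le_pos; [exact Ha|left; now apply Rinv_0_lt_compat]).
replace a with (m * (a / m)) at 1 by (field; lra).
apply Rmult_lt_compat_l; nra.
Qed.

Lemma open_norm_lt (E : NormedSpace) (r : R) : open (fun x : E => norm x < r).
Proof.
intros x Hx; apply locally_norm_iff; exists (r - norm x); split; [lra|].
intros y Hy; generalize (norm_le_minus _ y x); lra.
Qed.

(** Taking adjoints does not increase norms of differences, so the coercivity
    of the adjoint of the input map at the origin survives, with twice the
    constant, near the origin. *)
Lemma input_map_coercive (X U Y : RealHilbert) (g : X -> Lin U X) (dM : X -> Lin X Y) :
  continuous (input_map X U Y g dM) zero ->
  (forall y, exists u, dM zero (g zero u) = y) ->
  exists K r, 0 < K /\ 0 < r /\ forall x, norm x < r -> forall y,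
    norm y <= K * norm (adjoint (input_map X U Y g dM x) y).
Proof.
intros Hc Hsurj; set (N := input_map X U Y g dM) in *.
destruct (surjective_adjoint_coercive U Y (N zero) Hsurj) as [K [HK Hco]].
destruct (proj1 (continuous_norm_iff X _ N zero) Hc (/ (2 * K))) as [r [Hr H]];
  [apply Rinv_0_lt_compat; lra|].
exists (2 * K), r; split; [lra|split; [exact Hr|]]; intros x Hx y.
assert (Hx' : norm (minus x zero) < r).
{ apply Rle_lt_trans with (2 := Hx), Req_le.
  apply (f_equal (fun z : X => norm z)); module_eq X. }
specialize (H x Hx').
assert (H1 := lin_bound_minus _ _ (adjoint (N zero)) (adjoint (N x)) y).
assert (H2 := adjoint_minus_norm _ _ (N zero) (N x)).
assert (H3 : norm (minus (adjoint (N zero)) (adjoint (N x))) * norm y <= / (2 * K) * norm y).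
{ apply Rmult_le_compat_r; [apply norm_ge_0|].
  apply Rle_trans with (1 := H2); rewrite norm_minus_sym; left; exact H. }
assert (H4 := norm_le_minus _ (adjoint (N zero) y) (adjoint (N x) y)).
assert (H5 : norm (adjoint (N zero) y) <= / (2 * K) * norm y + norm (adjoint (N x) y))
  by (apply Rle_trans with (1 := H4), Rplus_le_compat_r, Rle_trans with (1 := H1), H3).
assert (H6 := Rle_trans _ _ _ (Hco y) (Rmult_le_compat_l K _ _ (Rlt_le _ _ HK) H5)).
replace (K * (/ (2 * K) * norm y + norm (adjoint (N x) y)))
  with (/ 2 * norm y + K * norm (adjoint (N x) y)) in H6 by (field; lra).
assert (Hhalf : forall a c, a <= / 2 * a + K * c -> a <= 2 * K * c) by (intros; lra).
exact (Hhalf _ _ H6).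
Qed.

Lemma state_small (X Y : RealHilbert) (M : X -> Y) :
  continuous M zero -> M zero = zero ->
  forall eps, 0 < eps -> exists r, 0 < r /\ forall w : state_space X Y,
    norm (fst w) < r -> norm (deviation X Y M w) < r -> norm w < eps.
Proof.
intros Hc H0 eps Heps.
destruct (proj1 (continuous_norm_iff X Y M zero) Hc (eps / 3) ltac:(lra)) as [r [Hr H]].
exists (Rmin r (eps / 3)); split; [apply Rmin_pos; lra|]; intros w Hx Hq.
assert (Hx1 := Rlt_le_trans _ _ _ Hx (Rmin_l _ _)).
assert (Hx2 := Rlt_le_trans _ _ _ Hx (Rmin_r _ _)).
assert (Hq2 := Rlt_le_trans _ _ _ Hq (Rmin_r _ _)).
assert (Hz : forall (E : RealHilbert) (v : E), norm (minus v zero) = norm v)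
  by (intros E v; apply (f_equal (fun z : E => norm z)); module_eq E).
assert (HMx : norm (M (fst w)) < eps / 3).
{ apply Rle_lt_trans with (2 := H (fst w) (Rle_lt_trans _ _ _ (Req_le _ _ (Hz X _)) Hx1)).
  apply Req_le; change (norm (M (fst w)) = norm (minus (M (fst w)) (M zero) : Y)).
  rewrite H0; symmetry; apply Hz. }
assert (Hw := norm_prod_le X Y w).
assert (Hs := norm_le_minus Y (snd w) (M (fst w))).
unfold deviation in Hq2.
apply Rle_lt_trans with (1 := Hw).
apply Rle_lt_trans with (norm (fst w) +
  (norm (minus (snd w) (M (fst w)) : Y) + norm (M (fst w)))).
- apply Rplus_le_compat_l; exact Hs.
- lra.
Qed.

Theorem theorem3 (X U Y : RealHilbert)
    (T : R -> Lin X X) (D : X -> Prop) (A : X -> X)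
    (f : X -> X) (g : X -> Lin U X) (h : X -> Y) (C : X -> Y) (S : Lin Y Y)
    (M : X -> Y) (dM : X -> Lin X Y)
    (hT : is_C0_semigroup T) (hA : is_generator T D A)
    (hf : locally_lipschitz f) (hf0 : f zero = zero)
    (hg : locally_lipschitz g)
    (hh : locally_lipschitz h) (hh0 : h zero = zero)
    (hC : bounded_on_domain D A C)
    (hS : skew_adjoint S)
    (hISS : semiglobal_ISS D A f g)
    (hIG : invariant_graph D A f S C h M dM)
    (hrange : forall y : Y, exists u : U, dM zero (g zero u) = y)
    (hexp : exponentially_stable T)
    (hfin : finite_dimensional Y) :
  globally_asymptotically_stable (closed_loop_solution D A f g S C h M dM).
Proof.
destruct hISS as [[V [dV [beta [HV [[m1 [m2 [Hm1 [Hm2 HVq]]]] [Hbeta HVdiss]]]]]] Hlocal].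
destruct (hIG) as [HM [_ [HM0 _]]].
set (sol := closed_loop_solution D A f g S C h M dM).
set (q := half_deviation2 X Y M).
set (F := fun w : state_space X Y => V (fst w) + beta * q w : R_NormedModule).
assert (HMc : forall x, continuous M x) by (intros x; exact (C1_continuous _ _ M dM x HM)).
assert (Hqc : forall w, continuous q w).
{ intros w.
  exact (strict_diff_continuous _ _ _ _ _ (lin_linear _)
    (strict_diff_half_norm2 _ _ _ _ _
      (deviation_strict_diff X Y D A f S C h M dM hIG w))). }
assert (Hfunc : forall (W : X -> R_NormedModule) dW b, is_C1 W dW ->
  forall w : state_space X Y, continuous (fun w => W (fst w) + b * q w : R_NormedModule) w).
{ intros W dW b HW w.
  apply (@continuous_plus (state_space X Y) R_AbsRing R_NormedModule
    (fun w => W (fst w)) (fun w => b * q w)).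
  - apply (continuous_of_fst X Y R_NormedModule W); exact (C1_continuous _ _ W dW _ HW).
  - exact (@continuous_scal_r (state_space X Y) R_AbsRing R_NormedModule b q w (Hqc w)). }
assert (Hq0 : forall w, 0 <= q w).
{ intros w; change (0 <= / 2 * norm (deviation X Y M w) ^ 2).
  generalize (pow2_ge_0 (norm (deviation X Y M w))); lra. }
assert (sol_cont : forall (P : state_space X Y -> R_NormedModule) w0 w, sol w0 w ->
  (forall y, continuous P y) -> continuous_on (fun t => 0 <= t) (fun t => P (w t))).
{ intros P w0 w Hw HP.
  apply (continuous_on_postcomp (state_space X Y) R_UniformSpace); [|exact HP].
  exact (trajectory_continuous X U Y D A f g S C h M dM w0 w Hw). }
assert (q_dini : forall w0 w, sol w0 w -> forall t, 0 <= t ->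
  dini_le (fun s => q (w s)) t (- norm (control X U Y g M dM (w t)) ^ 2)).
{ intros w0 w Hw t Ht.
  exact (trajectory_dini_deviation X U Y D A f g S C h M dM hf hg hh hS hIG w0 w Hw t Ht). }
(* [beta * q] absorbs the gain [beta * norm u ^ 2] of the input. *)
assert (F_dini : forall w0 w, sol w0 w -> forall t, 0 <= t -> dini_le (fun s => F (w s)) t 0).
{ intros w0 w Hw t Ht.
  set (u := control X U Y g M dM (w t)).
  replace 0 with (beta * norm u ^ 2 + beta * (- norm u ^ 2)) by ring.
  apply dini_le_plus; [|apply dini_le_scal; [exact Hbeta|exact (q_dini w0 w Hw t Ht)]].
  apply (trajectory_dini_state X U Y D A f g S C h M dM hf hg hh hIG w0 w Hw V dV
    (fun _ => True) (fun u _ => beta * norm u ^ 2) t HV Ht); [|exact I| |].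
  - exact open_true.
  - intros u' x; apply continuous_const.
  - intros x u' Dx _; now apply HVdiss. }
assert (F_decr : forall w0 w, sol w0 w -> forall t, 0 <= t -> F (w t) <= F w0).
{ intros w0 w Hw t Ht.
  rewrite <- (trajectory_initial X U Y D A f g S C h M dM w0 w Hw).
  apply (antitone_of_dini (fun s => F (w s))); [|exact (F_dini w0 w Hw)|lra].
  apply (sol_cont F w0 w Hw); exact (Hfunc V dV beta HV). }
assert (F_x : forall w, m1 * norm (fst w) ^ 2 <= F w).
{ intros w; change (m1 * norm (fst w) ^ 2 <= V (fst w) + beta * q w).
  assert (Hx := proj1 (HVq (fst w))).
  assert (Hb : 0 <= beta * q w) by (apply Rmult_le_pos; [lra|apply Hq0]).
  apply Rle_trans with (1 := Hx).
  rewrite <- (Rplus_0_r (V (fst w))) at 1; apply Rplus_le_compat_l; exact Hb. }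
assert (F_q : forall w, beta * (/ 2 * norm (deviation X Y M w) ^ 2) <= F w).
{ intros w; change (beta * q w <= V (fst w) + beta * q w).
  assert (Hx := proj1 (HVq (fst w))).
  assert (Hb : 0 <= m1 * norm (fst w) ^ 2) by (apply Rmult_le_pos; [lra|apply pow2_ge_0]).
  rewrite <- (Rplus_0_l (beta * q w)) at 1; apply Rplus_le_compat_r.
  exact (Rle_trans _ _ _ Hb Hx). }
split.
- intros eps Heps.
  destruct (state_small X Y M (HMc zero) HM0 eps Heps) as [r [Hr Hsmall]].
  set (rho := Rmin (m1 * r ^ 2) (beta * / 2 * r ^ 2)).
  assert (Hrho : 0 < rho).
  { apply Rmin_pos; apply Rmult_lt_0_compat; try (apply pow_lt; lra); lra. }
  assert (F0 : F zero = 0).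
  { assert (Hd0 : norm (deviation X Y M zero) = 0).
    { apply eq_trans with (norm (minus zero zero : Y)); [|apply norm_minus_self].
      exact (f_equal (fun y : Y => norm (minus zero y : Y)) HM0). }
    assert (HV0 : V zero = 0).
    { assert (Hz := HVq zero); rewrite (@norm_zero R_AbsRing X) in Hz.
      apply Rle_antisym.
      - apply Rle_trans with (1 := proj2 Hz); right; ring.
      - apply Rle_trans with (2 := proj1 Hz); right; ring. }
    change (V zero + beta * (/ 2 * norm (deviation X Y M zero) ^ 2) = 0).
    rewrite Hd0; apply eq_trans with (0 + beta * (/ 2 * 0 ^ 2)); [|ring].
    now apply f_equal2. }
  destruct (proj1 (continuous_norm_iff _ R_NormedModule F zero)
    (Hfunc V dV beta HV zero) rho Hrho) as [delta [Hdelta Hd]].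
  exists delta; split; [exact Hdelta|]; intros w0 w Hw Hw0 t Ht.
  assert (HFw : F (w t) < rho).
  { apply Rle_lt_trans with (1 := F_decr w0 w Hw t Ht).
    assert (Hz : norm (minus w0 zero) < delta).
    { apply Rle_lt_trans with (2 := Hw0), Req_le.
      apply (f_equal (fun z : state_space X Y => norm z)); module_eq (state_space X Y). }
    specialize (Hd w0 Hz); change (Rabs (F w0 - F zero) < rho) in Hd.
    rewrite F0, Rminus_0_r in Hd.
    exact (Rle_lt_trans _ _ _ (Rle_abs _) Hd). }
  apply Hsmall.
  + apply lt_of_scaled_squares with m1; [exact Hm1|exact Hr|].
    apply Rle_lt_trans with (1 := F_x (w t)), Rlt_le_trans with (1 := HFw), Rmin_l.
  + apply lt_of_scaled_squares with (beta * / 2); [lra|exact Hr|].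
    rewrite Rmult_assoc at 1.
    apply Rle_lt_trans with (1 := F_q (w t)), Rlt_le_trans with (1 := HFw), Rmin_r.
- intros w0 w Hw.
  set (x := fun t => fst (w t)).
  assert (HF0 : 0 <= F w0).
  { apply Rle_trans with (2 := F_x w0), Rmult_le_pos; [lra|apply pow2_ge_0]. }
  (* [F] bounds [m1 * norm (x t) ^ 2] by [F w0], and [s < (s + 1) ^ 2] for
     [s = F w0 / m1]: the trajectory stays in the ball of radius [s + 1]. *)
  set (r := F w0 / m1 + 1).
  assert (Hr : 0 <= F w0 / m1)
    by (apply Rmult_le_pos; [exact HF0|left; now apply Rinv_0_lt_compat]).
  set (B := fun y : X => norm y < r).
  assert (HxB : forall t, 0 <= t -> B (x t)).
  { intros t Ht; apply lt_of_scaled_squares with m1; [exact Hm1|unfold r; lra|].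
    apply Rle_lt_trans with (1 := F_x (w t)), Rle_lt_trans with (1 := F_decr w0 w Hw t Ht).
    exact (lt_scaled_square (F w0) m1 Hm1 HF0). }
  destruct (Hlocal B) as [W [dW [alpha [b [HW [[k1 [k2 [Hk1 [Hk2 HWq]]]] [Halpha [Hb HWdiss]]]]]]]].
  { exists r; intros y Hy; left; exact Hy. }
  { apply open_norm_lt. }
  set (p := fun t => W (x t) : R).
  set (qt := fun t => q (w t) : R).
  set (G := fun t => p t + b * qt t).
  assert (Hp0 : forall t, k1 * norm (x t) ^ 2 <= p t) by (intros t; apply HWq).
  assert (G_dini : forall t, 0 <= t -> dini_le G t (- (alpha * p t))).
  { intros t Ht.
    set (u := control X U Y g M dM (w t)).
    replace (- (alpha * p t))
      with ((- alpha * p t + b * norm u ^ 2) + b * (- norm u ^ 2)) by ring.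
    apply dini_le_plus; [|apply dini_le_scal; [exact Hb|exact (q_dini w0 w Hw t Ht)]].
    apply (trajectory_dini_state X U Y D A f g S C h M dM hf hg hh hIG w0 w Hw W dW
      B (fun u y => - alpha * W y + b * norm u ^ 2) t HW Ht).
    - apply open_norm_lt.
    - exact (HxB t Ht).
    - intros u' y.
      apply (@continuous_plus X R_AbsRing R_NormedModule); [|apply continuous_const].
      exact (@continuous_scal_r X R_AbsRing R_NormedModule (- alpha) W y
        (C1_continuous _ _ W dW y HW)).
    - intros y u' Dy By; now apply HWdiss. }
  assert (qt_cont : continuous_on (fun t => 0 <= t) qt) by exact (sol_cont q w0 w Hw Hqc).
  assert (G_cont : continuous_on (fun t => 0 <= t) G)
    by exact (sol_cont _ w0 w Hw (Hfunc W dW b HW)).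
  assert (Hp : forall t, 0 <= p t).
  { intros t; apply Rle_trans with (2 := Hp0 t), Rmult_le_pos; [lra|apply pow2_ge_0]. }
  assert (Hqt : forall t, 0 <= qt t) by (intros t; apply Hq0).
  assert (HG : forall t, 0 <= G t).
  { intros t; apply Rplus_le_le_0_compat; [apply Hp|apply Rmult_le_pos; [lra|apply Hqt]]. }
  (* [qt] and [G] decrease, so both converge, and hence so does [p]; as [G]
     dissipates [alpha * p], the limit of [p] is zero, and thus [x] vanishes
     at infinity. *)
  destruct (decreasing_nonneg_is_lim qt) as [lq Hlq].
  { intros t _; apply Hqt. }
  { apply antitone_of_dini; [exact qt_cont|]; intros t Ht.
    apply dini_le_weaken with (2 := q_dini w0 w Hw t Ht).
    generalize (pow2_ge_0 (norm (control X U Y g M dM (w t)))); lra. }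
  destruct (decreasing_nonneg_is_lim G) as [lG HlG].
  { intros t _; apply HG. }
  { apply antitone_of_dini; [exact G_cont|]; intros t Ht.
    apply dini_le_weaken with (2 := G_dini t Ht).
    assert (0 <= alpha * p t) by (apply Rmult_le_pos; [lra|apply Hp]); lra. }
  assert (Hlp : is_lim p p_infty (lG - b * lq)).
  { apply is_lim_ext with (fun t => G t - b * qt t).
    - intros t; apply Rplus_minus_r.
    - apply is_lim_minus'; [exact HlG|].
      exact (is_lim_scal_l qt b p_infty lq Hlq). }
  assert (Hlp0 : lG - b * lq <= 0).
  { apply (dini_dissipation_lim G p alpha 0); [exact Halpha|lra|intros t _; apply HG| | |];
      assumption. }
  assert (x_small : forall e, 0 < e -> exists t0, 0 <= t0 /\ forall t, t0 < t -> norm (x t) < e).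
  { intros e He.
    destruct (proj1 (is_lim_infty_iff p _) Hlp (k1 * e ^ 2)) as [t0 Ht0].
    { apply Rmult_lt_0_compat; [exact Hk1|apply pow_lt; exact He]. }
    exists (Rmax 0 t0); split; [apply Rmax_l|]; intros t Ht.
    specialize (Ht0 t (Rle_lt_trans _ _ _ (Rmax_r _ _) Ht)); apply Rabs_def2 in Ht0.
    apply lt_of_scaled_squares with k1; [exact Hk1|exact He|].
    generalize (Hp0 t); lra. }
  (* Once [x] is close to the origin, the input controls the deviation, so
     [qt] dissipates a multiple of itself. *)
  destruct (input_map_coercive X U Y g dM) as [K [rK [HK [HrK Hco]]]].
  { exact (input_map_continuous X U Y D A f g S C h M dM hg hIG zero). }
  { exact hrange. }
  destruct (x_small rK HrK) as [t0 [Ht0 Hxt0]].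
  assert (Hlq0 : lq <= 0).
  { apply (dini_dissipation_lim qt qt (2 / K ^ 2) (t0 + 1)); [|lra|intros t _; apply Hqt| | |].
    - apply Rdiv_lt_0_compat; [lra|apply pow_lt; exact HK].
    - exact qt_cont.
    - intros t Ht.
      apply dini_le_weaken with (2 := q_dini w0 w Hw t ltac:(lra)).
      apply Ropp_le_contravar.
      assert (Hc := Hco (x t) (Hxt0 t ltac:(lra)) (deviation X Y M (w t))).
      unfold x in Hc; rewrite <- (control_eq X U Y g M dM (w t)) in Hc.
      set (u := norm (control X U Y g M dM (w t))) in *.
      change (2 / K ^ 2 * (/ 2 * norm (deviation X Y M (w t)) ^ 2) <= u ^ 2).
      assert (Hd0 := norm_ge_0 (deviation X Y M (w t))).
      apply Rle_trans with (2 / K ^ 2 * (/ 2 * (K * u) ^ 2)).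
      + apply Rmult_le_compat_l; [left; apply Rdiv_lt_0_compat; [lra|apply pow_lt; exact HK]|].
        apply Rmult_le_compat_l; [lra|]; apply pow_incr; split; [exact Hd0|exact Hc].
      + right; field; lra.
    - exact Hlq. }
  apply (filterlim_norm_iff (state_space X Y) (Rbar_locally p_infty)); intros eps Heps.
  destruct (state_small X Y M (HMc zero) HM0 eps Heps) as [rs [Hrs Hsmall]].
  destruct (x_small rs Hrs) as [t1 [_ Ht1]].
  destruct (proj1 (is_lim_infty_iff qt _) Hlq (/ 2 * rs ^ 2)) as [t2 Ht2].
  { apply Rmult_lt_0_compat; [lra|apply pow_lt; exact Hrs]. }
  exists (Rmax t1 t2); intros t Ht.
  assert (Hz : norm (minus (w t) zero) = norm (w t))
    by (apply (f_equal (fun z : state_space X Y => norm z)); module_eq (state_space X Y)).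
  apply Rle_lt_trans with (1 := Req_le _ _ Hz).
  apply Hsmall.
  + exact (Ht1 t (Rle_lt_trans _ _ _ (Rmax_l _ _) Ht)).
  + specialize (Ht2 t (Rle_lt_trans _ _ _ (Rmax_r _ _) Ht)); apply Rabs_def2 in Ht2.
    apply lt_of_scaled_squares with (/ 2); [lra|exact Hrs|].
    change (qt t < / 2 * rs ^ 2); lra.
Qed.
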